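(* Let $\lambda$ be an infinite cardinal number and let $\mathcal{C} = \{H_i \mid i \in I\}$ be a family of nontrivial groups. Assume that $2 \leq |I| \leq \lambda$, that $|H_i| \leq \lambda$ for every $i \in I$, and that $|H_k| = \lambda$ for at least one $k \in I$. Then there exist a simple group $S$ of cardinality $\lambda$ and, for each $i \in I$, an injective homomorphism $\varphi_i : H_i \to S$, such that for all $i, i' \in I$ with $i \neq i'$ and $|H_{i'}| = \lambda$, the group $S$ is generated by $\varphi_i(H_i) \cup \varphi_{i'}(H_{i'})$.
   Context: The image $\varphi_i(H_i)$ is the copy of $H_i$ in $S$; the embeddings $\varphi_i$ are fixed once, independently of the pair $(i,i')$ considered. *)

(* Defs.v *)
From mathcomp Require Import all_boot.
From mathcomp Require Import boolp classical_sets functions cardinality.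

Set Implicit Arguments.
Unset Strict Implicit.
Unset Printing Implicit Defensive.

Local Open Scope group_scope.
Local Open Scope classical_set_scope.

(* Groups are [groupType]s, of arbitrary cardinality; their choice structure
   is no restriction, since every type has one classically. *)
Definition nontrivial_group (G : groupType) : Prop := exists x : G, x <> 1.

(* [mem A] is the classical boolean membership predicate of the set [A];
   [group_closed] asks for [1] and closure under [x / y = x * y^-1]. *)
Definition is_subgroup (G : groupType) (A : set G) : Prop :=
  group_closed (mem A).

Definition is_normal_subgroup (G : groupType) (N : set G) : Prop :=
  is_subgroup N /\ forall x y : G, N x -> N (x ^ y).

Definition simple_group (G : groupType) : Prop :=
  nontrivial_group G /\
  forall N : set G, is_normal_subgroup N -> N = [set 1] \/ N = [set: G].

Definition generated_subgroup (G : groupType) (A : set G) : set G :=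
  smallest (@is_subgroup G) A.

(* Main.v *)
Require Import Defs.
From HB Require Import structures.
From mathcomp Require Import all_boot generic_quotient zify.
From mathcomp Require Import boolp classical_sets functions cardinality.

Set Implicit Arguments.
Unset Strict Implicit.
Unset Printing Implicit Defensive.

(** Enlarge the family by two more copies of a factor of cardinality lambda, so
that at least three factors have cardinality lambda.  In the free product of
the enlarged family, whenever a and b are nontrivial elements of two factors
and H_e is a third factor, of cardinality lambda, impose the relator
      b = y_0 a y_0^-1 a  y_1 a y_1^-1 a  ...  y_36 a y_36^-1 a
where the y_k are elements of H_e that, up to inversion, are used at no other
place.  There are only lambda relators, so every H_e of cardinality lambda has
enough elements ([inverse_free_family]; the count rests on the equality of
lambda * lambda and lambda, [infinite_pairing]).

Let S be a group in which the relators hold.  First, b lies in the subgroup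
generated by the factor of a and by H_e; hence any factor together with any
other factor of cardinality lambda generates S ([subgroup_all]).  Second, if
a = 1 in S then the right-hand side is 1, so b = 1; with three factors of
cardinality lambda at hand, every element of every factor dies
([letters_killed]).  Take a normal subgroup of the free product that contains
the relators and is maximal among those that miss one fixed a_0 <> 1 in some
factor.  In the quotient no nontrivial element of a factor dies, since a_0
would die with it, so the factors embed; and the quotient is simple, since a
nontrivial normal subgroup contains a_0 by maximality, hence everything.

What remains is that the relators do not kill a_0.  This is small cancellation:
as the y_k are used only once, two different relators, read cyclically and in
either direction, have no 18 consecutive letters in common, while their length
is 149 ([relators_sc]).  Instead of cancellation diagrams, the proof constructs
a set on which the factors act and on which every relator acts trivially
([small_cancellation_action]).  It is the union of a tower.  A stage of the
tower ([good_stage]) consists of actions of all the factors on one fixed set,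
the reduced words, and of a subset, the core; outside the core the actions are
free, so that trees hang off the core.  Consider a relator whose path starts in
the core and then leaves it.  The part of the cyclic path that lies in the core
is short, and both ends of it run into trees.  The new stage lets two half arcs
grow along these trees, and joins their ends by exchanging two points in the
action of a single factor: the action of that factor is conjugated by an
involution ([new_act]).  This is again an action, and no compatibility with the
other factors has to be respected.  Small cancellation makes half arcs of
different relators branch off early, so that the exchanges do not interfere,
and it shows that a long run of a relator in the new core belongs to a path
that has been closed ([new_stage_closed]), so that the construction can be
repeated.  In the union of all cores every relator acts trivially, and a_0
moves the base point. *)

(** * Cardinal arithmetic *)

Section Cardinals.
Local Open Scope classical_set_scope.
Local Open Scope card_scope.

Lemma card_le_injP (A B : Type) :
  ([set: A] #<= [set: B]) <-> exists f : A -> B, injective f.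
Proof.
split=> [/card_leP[f]|[f fi]].
  exists (fun a => sval (f (SigSub (mem_setT a)))) => x y /val_inj.
  by move=> /(inj (mem_setT _) (mem_setT _)) /(congr1 sval).
apply/card_leP.
have /injfunPex[g] : exists2 f : [set: A] -> [set: B],
  set_fun [set: [set: A]] [set: [set: B]] f & set_inj [set: [set: A]] f.
  exists (fun a => SigSub (mem_setT (f (sval a)))) => //.
  by move=> x y _ _ /(congr1 sval) /= /fi /val_inj.
by squash g.
Qed.

Section Zorn.
Variable T : Type.

Lemma chain_pair (F : set (set T)) x y : total_on F subset ->
  (\bigcup_(X in F) X) x -> (\bigcup_(X in F) X) y ->
  exists2 X, F X & X x /\ X y.
Proof.
move=> tot [X FX Xx] [Y FY Yy]; have [h|h] := tot _ _ FX FY.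
  by exists Y => //; split=> //; exact: h.
by exists X => //; split=> //; exact: h.
Qed.

(** With a starting point [A0], chains can be taken nonempty, so that [ok] may
    include conditions that fail for the empty union. *)
Lemma Zorn_above (ok : set (set T)) (A0 : set T) : ok A0 ->
  (forall F, F !=set0 -> (forall X, F X -> A0 `<=` X /\ ok X) ->
     total_on F subset -> ok (\bigcup_(X in F) X)) ->
  exists A, [/\ A0 `<=` A, ok A & forall B, A `<=` B -> ok B -> B `<=` A].
Proof.
move=> ok0 okU; have [|G [okG maxG]] := @Zorn_bigcup _ (fun G => ok (A0 `|` G)).
  move=> F okF tot.
  have [[X0 FX0]|noF] := pselect (exists X, F X); last first.
    suff -> : \bigcup_(X in F) X = set0 by rewrite setU0.
    by apply/seteqP; split=> // t [X FX _]; case: noF; exists X.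
  have -> : A0 `|` \bigcup_(X in F) X = \bigcup_(X in [set A0 `|` X | X in F]) X.
    apply/seteqP; split=> [t [A0t|[X FX Xt]]|t [_ [X FX <-] [A0t|Xt]]].
    - by exists (A0 `|` X0); [exists X0|left].
    - by exists (A0 `|` X); [exists X|right].
    - by left.
    - by right; exists X.
  apply: okU => [|_ [X FX <-]|_ _ [X FX <-] [Y FY <-]].
  - by exists (A0 `|` X0); exists X0.
  - by split; [exact: subsetUl|exact: okF].
  - by have [h|h] := tot _ _ FX FY; [left|right]; exact: setUS.
exists (A0 `|` G); split=> [||B AB okB]; [exact: subsetUl|by []|].
apply: contrapT => nBA; apply: (maxG B).
  split=> [t Gt|BG]; first by apply: AB; right.
  by apply: nBA => t /BG; right.
by rewrite setUidr // => t A0t; apply: AB; left.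
Qed.

End Zorn.

Section Pairing.
Variable L : Type.

Definition injects (A B : set L) := exists f : L -> L,
  (forall x, A x -> B (f x)) /\ (forall x y, A x -> A y -> f x = f y -> x = y).

(** A maximal partial injection is defined everywhere or onto. *)
Lemma injects_total (A B : set L) : injects A B \/ injects B A.
Proof.
pose ok (G : set (L * L)) := [/\ forall x y, G (x, y) -> A x /\ B y,
  forall x y y', G (x, y) -> G (x, y') -> y = y' &
  forall x x' y, G (x, y) -> G (x', y) -> x = x'].
have [|G [[GAB Gf Gi] maxG]] := @Zorn_bigcup _ ok.
  move=> F okF tot; split=> [x y [X /okF[h _ _] /h]|x y y' h h'|x x' y h h'] //.
  - by have [X /okF[_ fX _] [Xy Xy']] := chain_pair tot h h'; exact: fX Xy Xy'.
  - by have [X /okF[_ _ iX] [Xx Xx']] := chain_pair tot h h'; exact: iX Xx Xx'.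
have [[x0 [Ax0 nx0]]|allA] := pselect (exists x, A x /\ forall y, ~ G (x, y)); last first.
  left; have [|f fP] := @boolp.choice L L (fun x y => A x -> G (x, y)).
    move=> x.
    have [Ax|nA] := pselect (A x); last by exists x.
    apply: contrapT => nex; apply: allA; exists x; split=> // y Gxy.
    by apply: nex; exists y.
  exists f; split=> [x /fP/GAB[]//|x y /fP Gx /fP Gy e].
  by rewrite e in Gx; exact: Gi Gx Gy.
have [[y0 [By0 ny0]]|allB] := pselect (exists y, B y /\ forall x, ~ G (x, y)); last first.
  right; have [|f fP] := @boolp.choice L L (fun y x => B y -> G (x, y)).
    move=> y.
    have [By|nB] := pselect (B y); last by exists y.
    apply: contrapT => nex; apply: allB; exists y; split=> // x Gxy.
    by apply: nex; exists x.
  exists f; split=> [x /fP/GAB[]//|x y /fP Gx /fP Gy e].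
  by rewrite e in Gx; exact: Gf Gx Gy.
case: (maxG (G `|` [set (x0, y0)])).
  split; first by move=> p; left.
  by move=> /(_ (x0, y0)) h; apply: (nx0 y0); apply: h; right.
split.
- by move=> x y [/GAB//|[-> ->]].
- move=> x y y' [h|[ex ->]] [h'|[ex' ->]] //; first exact: Gf h h'.
    by rewrite ex' in h; case: (nx0 y).
  by rewrite ex in h'; case: (nx0 y').
- move=> x x' y [h|[-> ey]] [h'|[-> ey']] //; first exact: Gi h h'.
    by rewrite ey' in h; case: (ny0 x).
  by rewrite ey in h'; case: (ny0 x').
Qed.

Hypothesis L_inf : infinite_set [set: L].

(** Hessenberg's theorem.  Take a maximal injective operation [K], given by its
    graph, on a subset [A] of [L] that contains a copy of [nat].  If the
    complement of [A] injects into [A], then so does [L], and the operation is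
    pulled back to [L].  Otherwise the complement contains a copy of [A], and
    [K] extends to the union of [A] and its copy: the three new quarters of the
    square are coded into the copy, which contradicts maximality. *)
Lemma infinite_pairing : exists p : L -> L -> L,
  forall x y x' y', p x y = p x' y' -> x = x' /\ y = y'.
Proof.
have [nu nu_inj] : exists nu : nat -> L, injective nu by apply/card_le_injP/infiniteP.
pose dom (G : set (L * L * L)) x := exists z, G (x, x, z).
pose ok (G : set (L * L * L)) := [/\
  forall x y z, G (x, y, z) -> [/\ dom G x, dom G y & dom G z],
  forall x y, dom G x -> dom G y -> exists z, G (x, y, z),
  forall x y z z', G (x, y, z) -> G (x, y, z') -> z = z' &
  forall x y x' y' z, G (x, y, z) -> G (x', y', z) -> x = x' /\ y = y'].
pose G0 : set (L * L * L) := [set t | exists i j, t = (nu i, nu j, nu (pickle (i, j)))].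
have dom0 i : dom G0 (nu i) by exists (nu (pickle (i, i))), i, i.
have ok0 : ok G0.
  split=> [x y z [i [j [-> -> ->]]]//|x y||].
  - move=> [z [i [i' [-> _ _]]]] [z' [j [j' [-> _ _]]]].
    by exists (nu (pickle (i, j))), i, j.
  - by move=> x y z z' [i [j [-> -> ->]]] [i' [j' [/nu_inj <- /nu_inj <- ->]]].
  - move=> x y x' y' z [i [j [-> -> ->]]] [i' [j' [-> -> /nu_inj]]].
    by move=> /(pcan_inj pickleK)[-> ->].
have [|K [G0K [K1 K2 K3 K4] maxK]] := @Zorn_above _ ok G0 ok0.
  move=> F _ okF tot; have okX X (FX : F X) := (okF X FX).2.
  have sub X t : F X -> X t -> (\bigcup_(Y in F) Y) t by exists X.
  have dsub X x : F X -> dom X x -> dom (\bigcup_(Y in F) Y) x.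
    by move=> FX [z h]; exists z; exact: sub h.
  split.
  - move=> x y z [X FX Xt]; have [h _ _ _] := okX _ FX; have [dx dy dz] := h _ _ _ Xt.
    by split; [exact: dsub FX dx|exact: dsub FX dy|exact: dsub FX dz].
  - move=> x y [z h] [z' h']; have [X FX [Xx Xy]] := chain_pair tot h h'.
    have [_ total _ _] := okX _ FX.
    have [w Xw] := total x y (ex_intro _ z Xx) (ex_intro _ z' Xy).
    by exists w; exact: sub Xw.
  - move=> x y z z' h h'; have [X FX [h1 h2]] := chain_pair tot h h'.
    by have [_ _ f _] := okX _ FX; exact: f h1 h2.
  - move=> x y x' y' z h h'; have [X FX [h1 h2]] := chain_pair tot h h'.
    by have [_ _ _ f] := okX _ FX; exact: f h1 h2.
pose A := dom K.
have Anu i : A (nu i) by have [z h] := dom0 i; exists z; exact: G0K.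
have [|p pP] := @boolp.choice _ _ (fun xy z => A xy.1 -> A xy.2 -> K (xy.1, xy.2, z)).
  move=> -[x y] /=.
  have [[Ax Ay]|nA] := pselect (A x /\ A y).
    by have [z h] := K2 _ _ Ax Ay; exists z.
  by exists x => Ax Ay; case: nA.
have pK x y : A x -> A y -> K (x, y, p (x, y)) by move=> Ax Ay; apply: (pP (x, y)).
have pA x y : A x -> A y -> A (p (x, y)) by move=> Ax Ay;
  have [_ _] := K1 _ _ _ (pK _ _ Ax Ay).
have pI x y x' y' : A x -> A y -> A x' -> A y' -> p (x, y) = p (x', y') -> x = x' /\ y = y'.
  by move=> ? ? ? ? e; apply: (K4 _ _ _ _ (p (x, y))); [exact: pK|rewrite e; exact: pK].
(* [nu 0] and [nu 1] tell the points of [A] from the others *)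
have [[f [fA fI]]|[be [beA beI]]] := injects_total (~` A) A.
  pose e x := if `[< A x >] then p (nu 0, x) else p (nu 1, f x).
  have eA x : A (e x).
    by rewrite /e; case: asboolP => Ax; apply: pA => //; exact: fA.
  have eI x x' : e x = e x' -> x = x'.
    rewrite /e; case: asboolP => Ax; case: asboolP => Ax' /pI[] //; try exact: fA.
    - by move=> /nu_inj.
    - by move=> /nu_inj.
    by move=> _; exact: fI.
  exists (fun x y => p (e x, e y)) => x y x' y' /pI[] //.
  by move=> /eI -> /eI ->.
pose sh (i : bool) a := if i then be a else a.
have shI i a i' a' : A a -> A a' -> sh i a = sh i' a' -> i = i' /\ a = a'.
  case: i i' => -[] /= Aa Aa' h.
  - by split=> //; exact: beI h.
  - by case: (beA _ Aa); rewrite h.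
  - by case: (beA _ Aa'); rewrite -h.
  by [].
have shA i a : A a -> A (sh i a) -> i = false by case: i => //= /beA.
(* the pair (i, j), which is not (false, false), names one of the new quarters *)
pose val (i j : bool) a b := be (p (nu (pickle (i, j)), p (a, b))).
pose new : set (L * L * L) := [set t | exists i j a b,
  [/\ A a, A b, i || j & t = (sh i a, sh j b, val i j a b)]].
have newval i j a b : A a -> A b -> ~ A (val i j a b).
  by move=> Aa Ab; apply: (beA _ (pA _ _ (Anu _) (pA _ _ Aa Ab))).
have valI i j a b i' j' a' b' : A a -> A b -> A a' -> A b' ->
    val i j a b = val i' j' a' b' -> [/\ i = i', j = j', a = a' & b = b'].
  move=> Aa Ab Aa' Ab' /beI h; have /pI[] :=
    h (pA _ _ (Anu _) (pA _ _ Aa Ab)) (pA _ _ (Anu _) (pA _ _ Aa' Ab'));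
    try exact: Anu; try exact: pA.
  by move=> /nu_inj/(pcan_inj pickleK)[-> ->] /pI[] // -> ->.
suff ok_new : ok (K `|` new).
  have /(maxK _ (@subsetUl _ _ _) ok_new) Kt :
      (K `|` new) (be (nu 0), be (nu 0), val true true (nu 0) (nu 0)).
    by right; exists true, true, (nu 0), (nu 0).
  by have [/(beA _ (Anu 0))] := K1 _ _ _ Kt.
have domK x : A x -> dom (K `|` new) x by move=> [z h]; exists z; left.
have domsh i a : A a -> dom (K `|` new) (sh i a).
  case: i => Aa; last exact: domK.
  by exists (val true true a a); right; exists true, true, a, a.
have dom_sh x : dom (K `|` new) x -> exists i a, A a /\ x = sh i a.
  move=> [z [h|[i [j [a [b [Aa _ _ [-> _ _]]]]]]]].
    by exists false, x; split=> //; exists z.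
  by exists i, a.
split.
- move=> x y z [/K1[d1 d2 d3]|[i [j [a [b [Aa Ab ij [-> -> ->]]]]]]].
    by split; exact: domK.
  split; [exact: domsh|exact: domsh|apply: (@domsh true)].
  exact: pA (Anu _) (pA _ _ Aa Ab).
- move=> x y /dom_sh[i [a [Aa ->]]] /dom_sh[j [b [Ab ->]]].
  have [ij|] := boolP (i || j).
    by exists (val i j a b); right; exists i, j, a, b.
  by case: i; case: j => //= _; have [z h] := K2 _ _ Aa Ab; exists z; left.
- move=> x y z z' [h|[i [j [a [b [Aa Ab ij [ex ey ->]]]]]]]
    [h'|[i' [j' [a' [b' [Aa' Ab' ij' [ex' ey' ->]]]]]]].
  + exact: K3 h h'.
  + have [d1 d2 _] := K1 _ _ _ h; rewrite ex' in d1; rewrite ey' in d2.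
    by rewrite (shA _ _ Aa' d1) (shA _ _ Ab' d2) in ij'.
  + have [d1 d2 _] := K1 _ _ _ h'; rewrite ex in d1; rewrite ey in d2.
    by rewrite (shA _ _ Aa d1) (shA _ _ Ab d2) in ij.
  + rewrite ex in ex'; rewrite ey in ey'.
    by have [-> ->] := shI _ _ _ _ Aa Aa' ex'; have [-> ->] := shI _ _ _ _ Ab Ab' ey'.
- move=> x y x' y' z [h|[i [j [a [b [Aa Ab ij [-> -> ez]]]]]]]
    [h'|[i' [j' [a' [b' [Aa' Ab' ij' [-> -> ez']]]]]]].
  + exact: K4 h h'.
  + by have [_ _] := K1 _ _ _ h; rewrite ez' => /(newval _ _ _ _ Aa' Ab').
  + by have [_ _] := K1 _ _ _ h'; rewrite ez => /(newval _ _ _ _ Aa Ab).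
  + by rewrite ez in ez'; have [] := valI _ _ _ _ _ _ _ _ Aa Ab Aa' Ab' ez' => -> -> -> ->.
Qed.

End Pairing.

Lemma infinite_seq (L : Type) : infinite_set [set: L] ->
  exists e : seq L -> L, injective e.
Proof.
move=> L_inf; have [p pI] := infinite_pairing L_inf.
have [nu nu_inj] : exists nu : nat -> L, injective nu by apply/card_le_injP/infiniteP.
pose fold s := foldr p (nu 0) s.
(* the size is recorded because [fold] alone does not mark the end of the list *)
exists (fun s => p (nu (size s)) (fold s)) => s t /pI[/nu_inj].
elim: s t => [|x s IH] [|y t] //= [] /IH{}IH /pI[-> /IH ->].
by [].
Qed.

(** The classes {x, x^-1} are as numerous as the elements of [K], since an
    element is given by its class and one bit; so [T] embeds into a system [R]
    of representatives. *)
Lemma inverse_free_family (K : groupType) (T : Type) (tau : T -> K) :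
  infinite_set [set: K] -> injective tau ->
  exists y : T -> K, (forall t, y t != 1%g) /\
    forall t t', y t = y t' \/ y t = (y t')^-1%g -> t = t'.
Proof.
move=> K_inf tauI.
pose r (x : K) : K := xget 1%g [set z | z = x \/ z = x^-1%g].
have rP x : r x = x \/ r x = x^-1%g.
  have : exists z, [set z | z = x \/ z = x^-1%g] z by exists x; left.
  exact: (xgetPex 1%g).
have rV x : r x^-1%g = r x.
  rewrite /r; congr xget; apply/seteqP; rewrite invgK.
  by split=> z /= [->|->]; [right|left|right|left].
have rr x : r (r x) = r x by case: (rP x) => e; rewrite {1}e ?rV.
pose R := {z : K | r z == z}.
pose rho x : R := exist _ (r x) (introT eqP (rr x)).
have flagI x x' : r x = r x' -> (x == r x) = (x' == r x') -> x = x'.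
  move=> e.
  have [/esym ex|nx] := eqVneq x (r x); have [/esym ex'|nx'] := eqVneq x' (r x') => // _.
    by rewrite -ex -ex' e.
  case: (rP x) nx => [->|ex]; rewrite ?eqxx // => _.
  case: (rP x') nx' => [->|ex']; rewrite ?eqxx // => _.
  by apply: (@invg_inj K); rewrite -ex -ex' e.
have [R_inf|R_fin] := pselect (infinite_set [set: R]); last first.
  have R_fin' : finite_set [set: R] by apply: contrapT.
  case: K_inf; apply: (card_le_finite (B := [set: R * bool])); last first.
    by rewrite -setXTT; apply: finite_setX.
  apply/card_le_injP; exists (fun x => (rho x, x == r x)) => x x' [].
  exact: flagI.
have [p pI] := infinite_pairing R_inf.
have [nu nu_inj] : exists nu : nat -> R, injective nu by apply/card_le_injP/infiniteP.
have [kap kapI] : exists kap : K -> R, injective kap.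
  exists (fun x => p (rho x) (nu (x == r x))) => x x' /pI[[/= e] /nu_inj flag].
  by apply: flagI e _; case: (x == r x) (x' == r x') flag => -[].
pose f (b : bool) t : R := p (nu b) (kap (tau t)).
have fI b b' t t' : sval (f b t) = sval (f b' t') -> b = b' /\ t = t'.
  move=> /val_inj/pI[/nu_inj + /kapI/tauI ->]; by case: b b' => -[].
(* of the two families with disjoint images, one misses 1 *)
have [b bP] : exists b, forall t, sval (f b t) != 1%g.
  have [[t0 /eqP h]|no] := pselect (exists t, sval (f true t) = 1%g).
    exists false => t; apply/eqP => h'; rewrite -(eqP h) in h'.
    by have [] := fI _ _ _ _ h'.
  by exists true => t; apply/eqP => h; apply: no; exists t.
exists (fun t => sval (f b t)); split=> // t t' h.
suff /fI[] : sval (f b t) = sval (f b t') by [].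
by case: h => [//|h]; rewrite -(eqP (svalP (f b t))) h rV (eqP (svalP (f b t'))).
Qed.

End Cardinals.

(** * Words in the letters of a family of groups, and actions on them *)

Section Words.
Local Open Scope group_scope.
Variables (I : choiceType) (H : I -> groupType).
Local Notation letter := {i : I & H i}.
Local Notation word := (seq letter).

Definition letter_inv (a : letter) : letter := Tagged H (tagged a)^-1.
Definition word_inv (w : word) : word := rev (map letter_inv w).
Definition reduced (w : word) : bool :=
  all (fun a : letter => tagged a != 1) w && sorted (fun a b : letter => tag a != tag b) w.

Lemma letter_invK : involutive letter_inv.
Proof. by case=> i x; rewrite /letter_inv /= invgK. Qed.

Lemma word_invK : involutive word_inv.
Proof. by move=> w; rewrite /word_inv map_rev revK mapK //; apply: letter_invK. Qed.

Lemma size_word_inv w : size (word_inv w) = size w.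
Proof. by rewrite size_rev size_map. Qed.

Lemma word_inv_cat u v : word_inv (u ++ v) = word_inv v ++ word_inv u.
Proof. by rewrite /word_inv map_cat rev_cat. Qed.

Lemma word_inv_rcons a u : word_inv (rcons u a) = letter_inv a :: word_inv u.
Proof. by rewrite /word_inv map_rcons rev_rcons. Qed.

Lemma word_inv_rot n w : n <= size w -> word_inv (rot n w) = rot (size w - n) (word_inv w).
Proof. by move=> le; rewrite /word_inv map_rot rev_rot /rotr size_rev size_map. Qed.

Lemma take_word_inv n w : take n (word_inv w) = word_inv (drop (size w - n) w).
Proof. by rewrite /word_inv take_rev size_map map_drop. Qed.

Lemma drop_word_inv n w : drop n (word_inv w) = word_inv (take (size w - n) w).
Proof. by rewrite /word_inv drop_rev size_map map_take. Qed.

Lemma reduced_cat u v : reduced (u ++ v) -> reduced u /\ reduced v.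
Proof.
rewrite /reduced all_cat => /andP[/andP[-> ->] /=].
case: u => [|a u] //=; rewrite cat_path => /andP[-> /=].
by move/path_sorted.
Qed.

Lemma reduced_take n w : reduced w -> reduced (take n w).
Proof. by rewrite -{1}(cat_take_drop n w) => /reduced_cat[]. Qed.

Lemma reduced_rcons2 w a b :
  reduced (rcons (rcons w a) b) =
  [&& reduced (rcons w a), tagged b != 1 & tag a != tag b].
Proof.
rewrite /reduced 2!all_rcons; case: w => [|c w] /=; first by rewrite !andbT;
  do !case: (_ != _).
rewrite !rcons_path last_rcons; do !case: (_ != _) => //=; by rewrite !(andbT,andbF).
Qed.

Lemma reduced1 (a : letter) : reduced [:: a] = (tagged a != 1).
Proof. by rewrite /reduced /= !andbT. Qed.

Lemma reduced_rcons_cat w a b u :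
  reduced (rcons w a) -> reduced (b :: u) -> tag a != tag b ->
  reduced (rcons w a ++ b :: u).
Proof.
rewrite /reduced all_cat => /andP[-> s1] /andP[-> s2] ab /=.
case: w s1 => [|c w] /= s1; first by rewrite ab.
by rewrite cat_path s1 /= last_rcons ab.
Qed.

Definition is_action (Om : Type) (act : Om -> letter -> Om) : Prop :=
  (forall p i, act p (Tagged H (1 : H i)) = p) /\
  (forall p i (x y : H i),
     act (act p (Tagged H x)) (Tagged H y) = act p (Tagged H (x * y))).

Section Action.
Variables (Om : Type) (act : Om -> letter -> Om).
Hypothesis actP : is_action act.

Lemma act_triv p (a : letter) : tagged a = 1 -> act p a = p.
Proof. by case: a => i x /= ->; apply: actP.1. Qed.

Lemma actK p a : act (act p a) (letter_inv a) = p.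
Proof. by case: a => i x; rewrite actP.2 mulgV actP.1. Qed.

Lemma actVK p a : act (act p (letter_inv a)) a = p.
Proof. by rewrite -{2}(letter_invK a) actK. Qed.

Definition run_word p (w : word) := foldl act p w.

Lemma run_cat p u v : run_word p (u ++ v) = run_word (run_word p u) v.
Proof. exact: foldl_cat. Qed.

Lemma run_rcons p u a : run_word p (rcons u a) = act (run_word p u) a.
Proof. by rewrite -cats1 run_cat. Qed.

Lemma runK p w : run_word (run_word p w) (word_inv w) = p.
Proof.
elim/last_ind: w p => [|w a IH] p //.
by rewrite word_inv_rcons run_rcons /= actK IH.
Qed.

Lemma runVK p w : run_word (run_word p (word_inv w)) w = p.
Proof. by rewrite -{2}(word_invK w) runK. Qed.

Lemma run_take_word_inv p r s : run_word p r = p -> s <= size r ->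
  run_word p (take s (word_inv r)) = run_word p (take (size r - s) r).
Proof.
move=> cl le; rewrite take_word_inv.
rewrite -{1}cl -{1}(cat_take_drop (size r - s) r) run_cat runK //.
Qed.

End Action.
End Words.

(** * The free product acting on its reduced words *)

Section Free.
Local Open Scope group_scope.
Variables (I : choiceType) (H : I -> groupType).
Local Notation letter := {i : I & H i}.
Local Notation word := (seq letter).

(** Right multiplication in the free product; the reduced word [s] is read
    from its last letter to its first. *)
Definition push (s : word) (a : letter) : word :=
  if tagged a == 1 then s else
  if s is b :: s' then
    if tag b == tag a then
      let x := tagged b * tagged_as b a in
      if x == 1 then s' else Tagged H x :: s'
    else a :: s
  else [:: a].

Lemma push_neq (s : word) (a : letter) : tagged a != 1 ->
  (if s is b :: _ then tag b != tag a else true) -> push s a = a :: s.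
Proof. by rewrite /push => /negPf->; case: s => [|b s] // /negPf->. Qed.

Lemma push_eq s i (x y : H i) : y != 1 ->
  push (Tagged H x :: s) (Tagged H y) =
  if x * y == 1 then s else Tagged H (x * y) :: s.
Proof. by rewrite /push /= => /negPf ->; rewrite eqxx tagged_asE. Qed.

Lemma push1 s i : push s (Tagged H (1 : H i)) = s.
Proof. by rewrite /push eqxx. Qed.

Lemma reduced_cons2 (a b : letter) (s : word) :
  reduced (a :: b :: s) = [&& tagged a != 1, tag a != tag b & reduced (b :: s)].
Proof. by rewrite /reduced /=; do !case: (_ != _) => //=; rewrite andbF. Qed.

Lemma reduced_cons_tag i (x y : H i) s : y != 1 ->
  reduced (Tagged H x :: s) -> reduced (Tagged H y :: s).
Proof.
case: s => [|b s] y1; first by rewrite !reduced1.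
by rewrite !reduced_cons2 y1 => /andP[_ ->].
Qed.

Lemma reduced_push s a : reduced s -> reduced (push s a).
Proof.
move=> rs; have [/eqP a1|a1] := boolP (tagged a == 1).
  by rewrite /push a1 eqxx.
case: s rs => [|[i x] s] rs; first by rewrite push_neq ?reduced1.
case: a a1 => j y /= y1.
have [ij|ij] := eqVneq i j; last first.
  by rewrite push_neq // reduced_cons2 rs y1 /= eq_sym ij.
subst j; rewrite push_eq //; case: ifP => [_|/negbT xy].
  by have /reduced_cat[] : reduced ([:: Tagged H x] ++ s) by [].
exact: reduced_cons_tag xy rs.
Qed.

Lemma pushM s i (x y : H i) : reduced s ->
  push (push s (Tagged H x)) (Tagged H y) = push s (Tagged H (x * y)).
Proof.
move=> rs.
have [->|x1] := eqVneq x 1; first by rewrite push1 mul1g.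
have [->|y1] := eqVneq y 1; first by rewrite push1 mulg1.
case: s rs => [|[j z] s] rs.
  by rewrite (@push_neq _ (Tagged H x)) // push_eq.
have [ij|ij] := eqVneq j i; last first.
  rewrite (@push_neq _ (Tagged H x)) // push_eq //; case: ifP => [/eqP->|/negbT xy].
    by rewrite push1.
  by rewrite push_neq.
subst j; rewrite push_eq //.
have [zx|zx] := eqVneq (z * x) 1.
  have -> : z = x^-1 by apply: (mulIg x); rewrite zx mulVg.
  have [xy|xy] := eqVneq (x * y) 1.
    rewrite xy push1.
    have -> : y = x^-1 by apply: (mulgI x); rewrite xy mulgV.
    rewrite push_neq ?invg_eq1 //.
    by case: s rs => // b s; rewrite reduced_cons2 => /and3P[_ ? _]; rewrite eq_sym.
  rewrite push_eq // mulgA mulVg mul1g (negPf y1) push_neq //.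
  by case: s rs => // b s; rewrite reduced_cons2 => /and3P[_ ? _]; rewrite eq_sym.
rewrite push_eq // -mulgA.
have [xy|xy] := eqVneq (x * y) 1; last by rewrite push_eq.
rewrite xy push1 mulg1 ifF //; apply/negbTE.
case: s rs => [|b s]; first by rewrite reduced1.
by rewrite reduced_cons2 => /and3P[].
Qed.

Definition free_pt := {s : word | reduced s}.

Definition free_act (p : free_pt) (a : letter) : free_pt :=
  exist _ (push (sval p) a) (reduced_push a (svalP p)).

Lemma free_actP : is_action free_act.
Proof.
split=> [[s rs] i|[s rs] i x y]; apply: val_inj; rewrite /= ?push1 //.
exact: pushM.
Qed.

Definition free_base : free_pt := exist _ [::] isT.

Lemma run_free_base w : reduced w -> sval (run_word free_act free_base w) = rev w.
Proof.
elim/last_ind: w => [|w a IH] // rw.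
have [|rw' a1] := @reduced_cat _ _ w [:: a]; first by rewrite cats1.
rewrite run_rcons /= (IH rw') rev_rcons push_neq //.
  by rewrite -reduced1.
case/lastP: w rw {IH rw'} => [|w b]; first by [].
by rewrite reduced_rcons2 rev_rcons => /and3P[].
Qed.

Lemma run_free_base_inj u v : reduced u -> reduced v ->
  run_word free_act free_base u = run_word free_act free_base v -> u = v.
Proof.
by move=> ru rv /(congr1 sval); rewrite !run_free_base // => /(can_inj revK).
Qed.

End Free.

Lemma swap_involution (T : Type) (J : T -> T -> Prop) :
  (forall x y y', J x y -> J x y' -> y = y') ->
  (forall x x' y, J x y -> J x' y -> x = x') ->
  (forall x y z, J x y -> ~ J z x) ->
  exists th : T -> T, [/\ involutive th,
    forall x y, J x y -> th x = y /\ th y = x &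
    forall x, (forall y, ~ J x y /\ ~ J y x) -> th x = x].
Proof.
move=> fJ iJ dJ.
have ex x : exists y, (J x y \/ J y x) \/ y = x /\ (forall y, ~ J x y /\ ~ J y x).
  have [[y Jy]|no] := pselect (exists y, J x y \/ J y x); first by exists y; left.
  exists x; right; split=> // y; split=> Jy; apply: no; exists y; [left|right]; exact: Jy.
have [th thP] := choice ex.
have th1 x y : J x y -> th x = y /\ th y = x.
  move=> Jxy; split.
    case: (thP x) => [[J1|J1]|[_ /(_ y)[]]] //; first exact: fJ J1 Jxy.
    by case: (dJ _ _ _ Jxy J1).
  case: (thP y) => [[J1|J1]|[_ /(_ x)[]]] //; last exact: iJ J1 Jxy.
  by case: (dJ _ _ _ J1 Jxy).
have th0 x : (forall y, ~ J x y /\ ~ J y x) -> th x = x.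
  by move=> no; case: (thP x) => [[J1|J1]|[]] //; case: (no (th x)).
exists th; split=> // x.
have [[y [Jy|Jy]]|no] := pselect (exists y, J x y \/ J y x).
- by have [-> ->] := th1 _ _ Jy.
- by have [e1 e2] := th1 _ _ Jy; rewrite e2 e1.
have no' : forall y, ~ J x y /\ ~ J y x.
  by move=> y; split=> Jy; apply: no; exists y; [left|right].
by rewrite !(th0 x).
Qed.

(** * Closed cells *)

Section Cells.
Local Open Scope group_scope.
Variables (I : choiceType) (H : I -> groupType).
Local Notation letter := {i : I & H i}.
Local Notation word := (seq letter).

Lemma reduced_word_inv (w : word) : reduced w -> reduced (word_inv w).
Proof.
move=> /andP[aw sw]; apply/andP; split.
  rewrite all_rev all_map; apply/allP => a /(allP aw) /=.
  by rewrite invg_eq1.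
rewrite rev_sorted sorted_map; move: sw; case: (w) => //= a u.
by apply: sub_path => b c /=; rewrite eq_sym.
Qed.

Lemma reduced_tag (a0 : letter) w k : reduced w -> k.+1 < size w ->
  tag (nth a0 w k) != tag (nth a0 w k.+1).
Proof. by move=> /andP[_ sw] lt; exact: (sortedP a0 sw k lt). Qed.

Lemma reduced_nth (a0 : letter) w k : reduced w -> k < size w ->
  tagged (nth a0 w k) != 1.
Proof. by move=> /andP[/(all_nthP a0) aw _] lt; apply: aw. Qed.

Variables (Om : Type) (act : Om -> letter -> Om) (P : set Om).
Hypothesis actP : is_action act.

(** The cycle read along [r] from [p] is the boundary of a 2-cell, in the way
    relators bound the cells of a Cayley complex. *)
Definition cell_closed p (r : word) :=
  run_word act p r = p /\ forall s, P (run_word act p (take s r)).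

Lemma closed_rot p r k : k <= size r -> cell_closed p r ->
  cell_closed (run_word act p (take k r)) (rot k r).
Proof.
move=> le [cl inP]; split; first by rewrite /rot -run_cat catA cat_take_drop run_cat cl.
move=> s; rewrite /rot take_cat size_drop.
case: ifP => [lt|/negbT]; first by rewrite -run_cat -takeD.
by rewrite -leqNgt => ge; rewrite -run_cat catA cat_take_drop run_cat cl -take_min.
Qed.

Lemma closed_unrot p r k : k <= size r ->
  cell_closed (run_word act p (take k r)) (rot k r) -> cell_closed p r.
Proof.
move=> le cl; have /(closed_rot (k := size r - k)) := cl.
rewrite size_rot => /(_ (leq_subr _ _)).
have -> : rot (size r - k) (rot k r) = r.
  by rewrite -[in size r](size_rot k r) -/(rotr k _) rotK.
rewrite -run_cat {1}/rot take_size_cat ?size_drop // cat_take_drop.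
suff -> : run_word act p r = p by [].
have [] := cl; rewrite /rot -run_cat catA cat_take_drop run_cat => e _.
by rewrite -(runK actP (run_word act p r) (take k r)) e runK.
Qed.

Lemma closed_inv p r : cell_closed p r -> cell_closed p (word_inv r).
Proof.
move=> [cl inP]; split; first by rewrite -{1}cl runK.
move=> s; have [le|gt] := leqP s (size r); first by rewrite run_take_word_inv.
by rewrite take_oversize ?size_word_inv ?(ltnW gt) // -{1}cl runK //; have := inP 0;
  rewrite take0.
Qed.

(** Addresses of points: such a [w] is empty or starts with a step out of [P].
    If the action is free outside [P], then every point has at most one
    address; this is how the trees that hang off [P] are described. *)
Definition address p (w : word) :=
  [/\ P p, reduced w & w = [::] \/ ~ P (run_word act p (take 1 w))].

End Cells.

(** * One stage of the tower, and its limit *)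

Section Tower.
Variables (I : choiceType) (H : I -> groupType).
Local Notation letter := {i : I & H i}.
Local Notation word := (seq letter).
Variables (a0 : letter) (Rel : set word) (N M : nat).

(** [Rel] contains one of the two orientations of each relator.  The choice of
    an orientation serves to break the symmetry between the two ends of an arc. *)
Definition symmetrized : set word := [set r | Rel r \/ Rel (word_inv r)].

(** As relators may be rotated, [sc_piece] bounds all common pieces, not only
    common prefixes; [sc_inv] excludes relators conjugate to their inverses. *)
Record small_cancellation : Prop := SmallCancellation {
  sc_size : forall r, Rel r -> size r = N;
  sc_red : forall r, Rel r -> reduced r;
  sc_rot : forall r k, Rel r -> Rel (rot k r);
  sc_inv : forall r, Rel r -> ~ Rel (word_inv r);
  sc_piece : forall r r', symmetrized r -> symmetrized r' -> take M r = take M r' ->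
    r = r' }.

Hypothesis SC : small_cancellation.
Hypothesis M_gt0 : 0 < M.
Hypothesis N_big : 8 * M + 4 <= N.

(** From the middle of a run of this length, [2 * M] steps ahead or back stay
    among the interior points of the run, and they contain [M] steps along one
    half arc even when a joint is crossed on the way. *)
Let run_bound := 4 * M + 2.

Lemma sym_size r : symmetrized r -> size r = N.
Proof. by case=> /(sc_size SC) //; rewrite size_word_inv. Qed.

Lemma sym_red r : symmetrized r -> reduced r.
Proof. by case=> /(sc_red SC) // /reduced_word_inv; rewrite word_invK. Qed.

Lemma sym_inv r : symmetrized r -> symmetrized (word_inv r).
Proof. by case=> h; [right; rewrite word_invK|left]. Qed.

Lemma sym_rot k r : symmetrized r -> symmetrized (rot k r).
Proof.
move=> Rr; have [le|gt] := leqP k (size r); last by rewrite rot_oversize // ltnW.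
case: Rr => h; [left; exact: (sc_rot SC)|right].
by rewrite word_inv_rot //; exact: (sc_rot SC).
Qed.

Lemma Rel_rotE k r : symmetrized r -> Rel (rot k r) -> Rel r.
Proof.
move=> Rr; have [le|gt] := leqP k (size r); last by rewrite rot_oversize // ltnW.
move=> /(sc_rot SC (size r - k)).
by rewrite -{1}(size_rot k r) -/(rotr k _) rotK.
Qed.

(** A stage of the tower.  By [g_inj] the action is free outside the core, by
    [g_orb] an orbit of a factor is contained in the core as soon as two of its
    points are, and by [g_closed] only short runs of relators are left open. *)
Record good_stage (Om : Type) (act : Om -> letter -> Om) (P : set Om) : Prop := Good {
  g_act : is_action act;
  g_inj : forall p w p' w', address act P p w -> address act P p' w' ->
    run_word act p w = run_word act p' w' -> p = p' /\ w = w';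
  g_orb : forall p (a b : letter), P p -> tagged a != 1%g -> tag a = tag b ->
    P (act p a) -> P (act p b);
  g_closed : forall p r, symmetrized r -> (forall s, s <= run_bound ->
    P (run_word act p (take s r))) ->
    cell_closed act P p r }.

Section Step.
Variables (Om : Type) (act : Om -> letter -> Om) (P : set Om).
Hypothesis G : good_stage act P.
Let actP := g_act G.
Local Notation run := (run_word act).

(** The place [p] where the path of the relator [r] leaves the core; the
    position in the cyclic relator is absorbed by rotating [r]. *)
Definition exits p r := [/\ P p, symmetrized r & ~ P (run p (take 1 r))].

Lemma address_take p r s : exits p r -> address act P p (take s r).
Proof.
case=> Pp Rr out; split=> //; first exact/reduced_take/sym_red.
by case: s => [|s]; [left; rewrite take0|right; rewrite take_takel].
Qed.

Lemma address_nil p : P p -> address act P p [::].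
Proof. by split=> //; left. Qed.

(** Two exiting paths that meet after at least [M] steps have the same address
    there, so they follow the same relator from the same point. *)
Lemma exit_take_uniq p r p' r' s s' :
  exits p r -> exits p' r' -> M <= s -> s <= N -> s' <= N ->
  run p (take s r) = run p' (take s' r') -> [/\ p = p', r = r' & s = s'].
Proof.
move=> e e' Ms sN sN' /(g_inj G (address_take s e) (address_take s' e'))[-> eqt].
have [_ Rr _] := e; have [_ Rr' _] := e'.
have := congr1 size eqt; rewrite !size_takel ?sym_size // => ss'; subst s'.
split=> //; apply: (sc_piece SC) => //.
by rewrite -(take_takel r Ms) eqt take_takel.
Qed.

(** [b] is the number of letters for which the path, read backwards from [p],
    stays in the core. *)
Definition core_run p r b :=
  (forall s, s <= b -> P (run p (take s (word_inv r)))) /\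
  ~ P (run p (take b.+1 (word_inv r))).

Lemma core_run_uniq p r b b' : core_run p r b -> core_run p r b' -> b = b'.
Proof.
move=> [h1 h2] [h1' h2'].
have [lt|lt|//] := ltngtP b b'; by [case: h2; apply: h1'|case: h2'; apply: h1].
Qed.

Definition core_len p r := xget 0 (core_run p r).

(** A backward run of length [run_bound] would close the cell inside the core,
    and then the path would not exit at [p]. *)
Lemma exit_core_run p r : exits p r ->
    core_run p r (core_len p r) /\ core_len p r < run_bound.
Proof.
move=> e; have [Pp Rr out] := e.
have [b [bP bC]] : exists b, core_run p r b /\ b < run_bound.
  apply: contrapT => no.
  have all_in s : s <= run_bound -> forall t, t <= s -> P (run p (take t (word_inv r))).
    elim: s => [|s IH] sC t; first by rewrite leqn0 => /eqP->; rewrite take0.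
    rewrite leq_eqVlt => /predU1P[->|]; last by rewrite ltnS; apply: IH; lia.
    apply: contrapT => nP; apply: no; exists s; split; [split=> // u us|by lia].
    by apply: IH => //; lia.
  have /(closed_inv actP) : cell_closed act P p (word_inv r).
    by apply: (g_closed G); [apply: sym_inv|move=> s sC; apply: all_in sC _ _].
  by rewrite word_invK => -[_ /(_ 1)].
have : core_run p r (core_len p r) by apply: (xgetPex 0); exists b.
by move=> bkP; split=> //; rewrite (core_run_uniq bkP bP).
Qed.

(** The other end of the part of the cell that lies in the core, from which the
    reversed relator exits.  Passing to the far end is an involution ([farK]). *)
Definition far_base p r := run p (take (core_len p r) (word_inv r)).
Definition far_word p r := rot (core_len p r) (word_inv r).

Lemma core_len_lt p r : exits p r -> core_len p r < run_bound.
Proof. by case/exit_core_run. Qed.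

Lemma word_inv_far_word p r : exits p r -> word_inv (far_word p r) =
    rot (N - core_len p r) r.
Proof.
move=> e; have [_ Rr _] := e; have := core_len_lt e => lt.
by rewrite /far_word word_inv_rot ?size_word_inv ?word_invK ?sym_size //; lia.
Qed.

Lemma run_far_word_back p r s : exits p r -> s <= core_len p r ->
  run (far_base p r) (take s (word_inv (far_word p r))) =
    run p (take (core_len p r - s) (word_inv r)).
Proof.
move=> e le; have [_ Rr _] := e; have lt := core_len_lt e; have sr := sym_size Rr.
rewrite word_inv_far_word // /rot take_cat size_drop sr.
have -> : (if s < N - (N - core_len p r) then take s (drop (N - core_len p r) r)
   else drop (N - core_len p r) r ++ take (s - (N - (N - core_len p r))) (take (N - core_len p r) r))
   = take s (drop (N - core_len p r) r).
  case: ifP => // ge; have -> : s = N - (N - core_len p r) by lia.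
  by rewrite subnn take0 cats0 take_oversize // size_drop sr.
rewrite /far_base take_word_inv sr.
rewrite -{1}(cat_take_drop s (drop (N - core_len p r) r)) word_inv_cat run_cat runVK //.
rewrite drop_drop take_word_inv sr; congr (run p (word_inv (drop _ r))); lia.
Qed.

Lemma core_run_far p r : exits p r -> core_run (far_base p r) (far_word p r) (core_len p r).
Proof.
move=> e; have [[h1 h2] lt] := exit_core_run e; have [Pp Rr out] := e.
have sr := sym_size Rr.
split=> [s le|]; first by rewrite run_far_word_back //; apply: h1; lia.
have -> : run (far_base p r) (take (core_len p r).+1 (word_inv (far_word p r))) =
  run p (take 1 r) => //.
rewrite word_inv_far_word // /rot take_cat size_drop sr ifF; last by lia.
rewrite run_cat -{1}(take_oversize (s := drop _ r) (n := core_len p r)); last first.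
  by rewrite size_drop sr; lia.
have := run_far_word_back e (leqnn _); rewrite word_inv_far_word // /rot.
rewrite takel_cat ?size_drop ?sr; last by lia.
move=> ->; rewrite subnn take0 /= take_takel; last by lia.
by congr (run p (take _ r)); lia.
Qed.

Lemma exits_far p r : exits p r -> exits (far_base p r) (far_word p r).
Proof.
move=> e; have [[h1 h2] lt] := exit_core_run e; have [Pp Rr out] := e.
have sr := sym_size Rr.
split; [exact: h1|by apply/sym_rot/sym_inv|].
rewrite -[_.+1]addn1 takeD run_cat in h2; move: h2.
by rewrite /far_word /rot takel_cat // size_drop size_word_inv sr;
  rewrite /run_bound in lt; lia.
Qed.

Lemma core_len_far p r : exits p r -> core_len (far_base p r) (far_word p r) = core_len p r.
Proof.
by move=> e; apply: core_run_uniq (core_run_far e); case: (exit_core_run (exits_far e)).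
Qed.

Lemma farK p r : exits p r ->
  far_base (far_base p r) (far_word p r) = p /\ far_word (far_base p r) (far_word p r) = r.
Proof.
move=> e; have [_ Rr _] := e; have lt := core_len_lt e.
split; first by rewrite {1}/far_base core_len_far // run_far_word_back // subnn take0.
rewrite {1}/far_word core_len_far // word_inv_far_word // -{1}(sym_size Rr); exact: rotrK.
Qed.

Lemma Rel_far_word p r : exits p r -> Rel (far_word p r) <-> ~ Rel r.
Proof.
move=> e; have [_ Rr _] := e; split.
  by move=> /(Rel_rotE (sym_inv Rr)) h1 h2; exact: (sc_inv SC) h2 h1.
by case: Rr => // h _; exact: (sc_rot SC).
Qed.

(** The number of letters of the half arc grown from [p] along [r].  The two
    half arcs of a cell and the letter of their joint fill the part of the
    cyclic relator that lies outside the core ([half_len_far]); the positive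
    orientation gets a constant length, the opposite one gets the rest. *)
Definition half_len p r := if `[< Rel r >] then (2 * M).+1 else N - 1 - (2 * M).+1 - core_len p r.

Lemma half_len_far p r : exits p r ->
    half_len p r + half_len (far_base p r) (far_word p r) + core_len p r + 1 = N.
Proof.
move=> e; have lt := core_len_lt e; have := Rel_far_word e;
  rewrite /half_len core_len_far //.
by rewrite /run_bound in lt; case: asboolP => h1; case: asboolP => h2 h; (tauto || lia).
Qed.

Lemma half_len_ge p r : exits p r -> (2 * M).+1 <= half_len p r.
Proof.
by move=> e; have := core_len_lt e; rewrite /run_bound /half_len; case: asboolP; lia.
Qed.

Lemma half_len_lt p r : exits p r -> half_len p r + (2 * M).+1 < N.
Proof. by move=> e; have := half_len_far e; have := half_len_ge (exits_far e); lia. Qed.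

Definition joint_letter p r := nth a0 r (half_len p r).
Definition half_end p r := run p (take (half_len p r) r).

Lemma take_half_lenS p r : exits p r -> take (half_len p r).+1 r =
    rcons (take (half_len p r) r) (joint_letter p r).
Proof.
move=> e; have [_ Rr _] := e; have lt := half_len_lt e.
by rewrite (take_nth a0) // sym_size //; lia.
Qed.

Lemma joint_letter_far p r : exits p r -> joint_letter (far_base p r) (far_word p r) =
    letter_inv (joint_letter p r).
Proof.
move=> e; have [_ Rr _] := e; have h := half_len_far e; have sr := sym_size Rr.
rewrite /joint_letter; move: (half_len (far_base p r) _) h => m h.
rewrite /far_word /rot nth_cat size_drop size_word_inv sr ifT; last by lia.
rewrite nth_drop /word_inv nth_rev ?size_map ?sr; last by lia.
by rewrite (nth_map a0) ?sr; [congr (letter_inv (nth _ _ _)); lia|lia].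
Qed.

Definition on_arc p w := P p /\
  (w = [::] \/ exists r s, [/\ exits p r, 0 < s, s <= half_len p r & w = take s r]).

(** Addresses cut off by the exchange: of the orbit through the joint, only the
    copy at the positive end is kept, and in this copy the point reached by the
    joint letter is replaced by the end of the opposite half arc. *)
Definition past_joint p v c := exists r,
  [/\ exits p r, v = take (half_len p r) r, tag c = tag (joint_letter p r) & Rel r ->
    c = joint_letter p r].

Definition new_address p w := address act P p w /\
  (w = [::] \/ exists v c, [/\ w = rcons v c, on_arc p v & ~ past_joint p v c]).

(** The new core consists of the orbits of all the factors through all the
    points of the old core and of the half arcs, described by addresses over
    the old core. *)
Definition new_core : set Om := [set q | exists p w, new_address p w /\ q = run p w].

Definition joined i x y := exists p r, [/\ exits p r, Rel r, tag (joint_letter p r) = i,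
  x = run p (take (half_len p r).+1 r) & y = half_end (far_base p r) (far_word p r)].

(** Small cancellation makes each exchanged point belong to one cell only. *)
Lemma joint_swap i : exists th : Om -> Om, [/\ involutive th,
    forall x y, joined i x y -> th x = y /\ th y = x &
    forall x, (forall y, ~ joined i x y /\ ~ joined i y x) -> th x = x].
Proof.
apply: swap_involution.
- move=> x y y' [p [r [e Rr _ -> ->]]] [p' [r' [e' Rr' _ eqx ->]]].
  have m := half_len_lt e; have m' := half_len_lt e'; have g := half_len_ge e.
  by have [|||-> -> _] := exit_take_uniq e e' _ _ _ eqx; try lia.
- move=> x x' y [p [r [e Rr _ -> ->]]] [p' [r' [e' Rr' _ -> eqy]]].
  have o := exits_far e; have o' := exits_far e'.
  have m := half_len_lt o; have m' := half_len_lt o'; have g := half_len_ge o.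
  have [|||e1 e2 _] := exit_take_uniq o o' _ _ _ eqy; try lia.
  have [h1 h2] := farK e; have [h1' h2'] := farK e'.
  have -> : p = p' by rewrite -h1 e1 e2.
  by have -> : r = r' by rewrite -h2 e1 e2.
move=> x y z [p [r [e Rr _ -> _]]] [p' [r' [e' Rr' _ _ eqy]]].
have o' := exits_far e'.
have m := half_len_lt e; have m' := half_len_lt o'; have g := half_len_ge e.
have [|||e1 e2 _] := exit_take_uniq e o' _ _ _ eqy; try lia.
by rewrite e2 in Rr; exact: (Rel_far_word e').1 Rr Rr'.
Qed.

Definition joint_perm i := sval (cid (joint_swap i)).

(** Conjugating the action of one factor by an involution gives an action of
    this factor, hence an action of the free product. *)
Definition new_act q (c : letter) := joint_perm (tag c) (act (joint_perm (tag c) q) c).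
Local Notation run' := (run_word new_act).

Lemma joint_permK i : involutive (joint_perm i).
Proof. by rewrite /joint_perm; case: cid => th []. Qed.

Lemma new_actP : is_action new_act.
Proof.
split=> [p i|p i x y]; rewrite /new_act /= ?joint_permK ?actP.1 ?joint_permK //.
by rewrite actP.2.
Qed.

Definition joint_supp i x := exists y, joined i x y \/ joined i y x.

Lemma new_act_eq q c : ~ joint_supp (tag c) q -> ~ joint_supp (tag c) (act q c) ->
    new_act q c = act q c.
Proof.
have fix_ i x : ~ joint_supp i x -> joint_perm i x = x.
  rewrite /joint_perm; case: cid => th [_ _ h] /= ns; apply: h => y.
  by split=> j; apply: ns; exists y; [left|right].
by move=> n1 n2; rewrite /new_act (fix_ _ q n1) fix_.
Qed.

Lemma joint_supp_address i p w : address act P p w -> joint_supp i (run p w) ->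
  exists r, [/\ exits p r, tag (joint_letter p r) = i &
    Rel r /\ w = take (half_len p r).+1 r \/ ~ Rel r /\ w = take (half_len p r) r].
Proof.
move=> nw [y [[p' [r [e Rr ti eqx _]]]|[p' [r [e Rr ti _ eqy]]]]].
  have [e1 e2] := g_inj G nw (address_take _ e) eqx; subst p'.
  by exists r; split=> //; left.
have o := exits_far e.
have [e1 e2] := g_inj G nw (address_take _ o) eqy; rewrite e1 e2.
exists (far_word p' r); split=> //; first by rewrite joint_letter_far.
by right; split=> // /(Rel_far_word e).1.
Qed.

Lemma on_arc_nil p : P p -> on_arc p [::].
Proof. by split=> //; left. Qed.

Lemma on_arc_exit p r s : exits p r -> s <= half_len p r -> on_arc p (take s r).
Proof.
move=> e le; split; first by case: e.
by case: s le => [|s] le; [left; rewrite take0|right; exists r, s.+1].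
Qed.

Lemma on_arc_address p w : on_arc p w -> address act P p w.
Proof.
case=> Pp [->|[r [s [e _ _ ->]]]]; first exact: address_nil.
exact: address_take.
Qed.

Lemma on_arc_take p w k : on_arc p w -> on_arc p (take k w).
Proof.
case=> Pp [->|[r [s [e s0 sm ->]]]]; first exact: on_arc_nil.
by rewrite -take_min; apply: on_arc_exit => //; lia.
Qed.

Lemma on_arc_prefix p u v : on_arc p (u ++ v) -> on_arc p u.
Proof. by move=> /(on_arc_take (size u)); rewrite take_size_cat. Qed.

Lemma piece_take r r' k : symmetrized r -> symmetrized r' -> M <= k -> take k r =
    take k r' -> r = r'.
Proof.
move=> Rr Rr' Mk eqt; apply: (sc_piece SC) => //.
by rewrite -(take_takel r Mk) eqt take_takel.
Qed.

Lemma exit_half_uniq p r r' : exits p r -> exits p r' ->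
  take (half_len p r) r = take (half_len p r') r' -> r = r'.
Proof.
move=> e e' eqt; have := half_len_ge e; have := half_len_lt e;
  have := half_len_lt e' => m m' g.
have [|||_ eqr _] := exit_take_uniq e e' _ _ _ (congr1 (run p) eqt); try lia.
exact: eqr.
Qed.

(** A half arc that reached further would share more than [M] letters with the
    given one, so it would be the given one. *)
Lemma on_arc_end p r c : exits p r -> ~ on_arc p (rcons (take (half_len p r) r) c).
Proof.
move=> e Vc; have [Pp [|[r' [s [e' s0 sm eqt]]]]] := Vc.
  by move=> /(congr1 size); rewrite size_rcons.
have [_ Rr _] := e; have [_ Rr' _] := e'.
have lt := half_len_lt e; have lt' := half_len_lt e'; have g := half_len_ge e.
have := congr1 size eqt; rewrite size_rcons !size_takel ?sym_size //; try lia.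
move=> es; rewrite -es in eqt sm.
have eq_r : r = r'.
  apply: (@piece_take _ _ (half_len p r)) => //; first by lia.
  have := congr1 (take (half_len p r)) eqt; rewrite take_takel // => <-.
  by rewrite -cats1 take_size_cat // size_takel // sym_size //; lia.
by rewrite eq_r in sm; lia.
Qed.

Lemma on_arc_supp i p w : on_arc p w -> joint_supp i (run p w) ->
  exists r, [/\ exits p r, tag (joint_letter p r) = i, ~ Rel r & w = take (half_len p r) r].
Proof.
move=> Vw /(joint_supp_address (on_arc_address Vw))[r [e ti [[Rr ew]|[nR ew]]]];
  last by exists r.
by move: Vw; rewrite ew take_half_lenS // => /(on_arc_end e).
Qed.

(** The exchange only affects orbits through joints, and these are excluded. *)
Lemma new_act_step p u c : on_arc p u -> address act P p (rcons u c) ->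
    ~ past_joint p u c ->
  new_act (run p u) c = run p (rcons u c).
Proof.
move=> Vu nuc nrem; rewrite run_rcons; apply: new_act_eq.
  move=> /(on_arc_supp Vu)[r [e ti nR eu]].
  by apply: nrem; exists r.
rewrite -run_rcons => /(joint_supp_address nuc)[r [e ti [[Rr ew]|[nR ew]]]].
  move: ew; rewrite take_half_lenS // => /rcons_inj[eu ec].
  by apply: nrem; exists r.
have g := half_len_ge e; have lt := half_len_lt e; have [_ Rr _] := e.
have eqm : half_len p r = (half_len p r).-1.+1 by lia.
move: ew; rewrite {1}eqm (take_nth a0) ?sym_size //; last by lia.
move=> /rcons_inj[_ ec].
have lt2 : (half_len p r).-1.+1 < size r by rewrite sym_size //; lia.
by have := reduced_tag a0 (sym_red Rr) lt2; rewrite -eqm -ec -ti /joint_letter eqxx.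
Qed.

(** The exchange has been made so that the joint letter leads from the end of
    one half arc to the end of the other. *)
Lemma new_act_joint p r : exits p r -> new_act (half_end p r) (joint_letter p r) =
    half_end (far_base p r) (far_word p r).
Proof.
have main q s : exits q s -> Rel s -> new_act (half_end q s) (joint_letter q s) =
  half_end (far_base q s) (far_word q s).
  move=> e Rs; have j : joined (tag (joint_letter q s)) (act (half_end q s) (joint_letter q s)) (half_end (far_base q s) (far_word q s)).
    by exists q, s; split=> //; rewrite take_half_lenS // run_rcons.
  have ns : ~ joint_supp (tag (joint_letter q s)) (half_end q s).
    move=> /(on_arc_supp (on_arc_exit e (leqnn _)))[r' [e' _ nR]] /(exit_half_uniq e e') eqs.
    by rewrite eqs in Rs.
  move: ns j; rewrite /new_act /joint_perm; case: cid => th [_ h1 h2] /= ns j.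
  have -> : th (half_end q s) = half_end q s.
    by apply: h2 => y; split=> jj; apply: ns; exists y; [left|right].
  by case: (h1 _ _ j).
move=> e; have [Rr|nR] := pselect (Rel r); first exact: main.
have o := exits_far e; have [k1 k2] := farK e.
have := main _ _ o ((Rel_far_word e).2 nR); rewrite k1 k2 joint_letter_far // => <-.
by rewrite (actVK new_actP).
Qed.

Lemma on_arc_new_address p w : on_arc p w -> new_address p w.
Proof.
move=> Vw; split; first exact: on_arc_address.
case/lastP: w Vw => [|w c] Vw; first by left.
right; exists w, c; split=> //; first by move: Vw; rewrite -cats1 => /on_arc_prefix.
by move=> [r [e ew _ _]]; apply: (on_arc_end e (c := c)); rewrite -ew.
Qed.

Lemma on_arc_new_core p w : on_arc p w -> new_core (run p w).
Proof. by move=> Vw; exists p, w; split=> //; apply: on_arc_new_address. Qed.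

Lemma new_address_step p u c : new_address p (rcons u c) ->
  [/\ on_arc p u, address act P p (rcons u c) & new_act (run p u) c = run p (rcons u c)].
Proof.
move=> [nw [|[v [d [/rcons_inj[eu ed] Vu nr]]]]].
  by move=> /(congr1 size); rewrite size_rcons.
by subst v d; split=> //; apply: new_act_step.
Qed.

Lemma address_same_tag p u (c d : letter) : address act P p (rcons u c) -> tag c = tag d ->
  tagged d != 1%g -> address act P p (rcons u d).
Proof.
move=> [Pp ru out] cd d1.
have c1 : tagged c != 1%g.
  by move: ru; rewrite -cats1 => /reduced_cat[_]; rewrite reduced1.
split=> //.
  case/lastP: u ru {out} => [|u b]; first by rewrite !reduced1.
  by rewrite !reduced_rcons2 d1 -cd => /and3P[-> _ ->].
right; case: u out {ru} => [|b u] /= [] //.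
- by move=> + Pd; apply; apply: (g_orb G Pp d1) Pd.
- by rewrite !take0.
Qed.

(** At the top of a half arc whose orientation is not positive, the orbit is the
    one that was kept at the positive end. *)
Lemma new_core_out p u c : on_arc p u -> address act P p (rcons u c) ->
    new_core (new_act (run p u) c).
Proof.
move=> Vu nuc.
have c1 : tagged c != 1%g.
  by have [_ ru _] := nuc; move: ru; rewrite -cats1 => /reduced_cat[_]; rewrite reduced1.
have good_end q s d : exits q s -> Rel s -> tag d = tag (joint_letter q s) ->
  new_core (new_act (half_end q s) d).
  move=> e Rs td.
  have [d1|d1] := eqVneq (tagged d) 1%g.
    by rewrite (act_triv new_actP) //; apply: on_arc_new_core; apply: on_arc_exit.
  have [->|dj] := pselect (d = joint_letter q s).
    by rewrite new_act_joint //; apply: on_arc_new_core; apply: on_arc_exit => //;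
      apply: exits_far.
  have nd : address act P q (rcons (take (half_len q s) s) d).
    apply: (@address_same_tag _ _ (joint_letter q s)) => //;
      rewrite -take_half_lenS //; exact: address_take.
  have nr : ~ past_joint q (take (half_len q s) s) d.
    by move=> [s' [e' /(exit_half_uniq e e') <- _ h]]; apply: dj; apply: h.
  have Ve := on_arc_exit e (leqnn (half_len q s)).
  rewrite new_act_step //; exists q, (rcons (take (half_len q s) s) d); split=> //;
    split=> //.
  by right; exists (take (half_len q s) s), d.
have [[r [e eu tc h]]|nr] := pselect (past_joint p u c); last first.
  rewrite new_act_step //; exists p, (rcons u c); split=> //; split=> //.
  by right; exists u, c.
rewrite eu -/(half_end p r).
have [Rr|nR] := pselect (Rel r); first exact: good_end.
have o := exits_far e; have [k1 k2] := farK e.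
have := new_act_joint o; rewrite k1 k2 => <-.
have : tag (joint_letter (far_base p r) (far_word p r)) =
  tag c by rewrite joint_letter_far // tc.
have := (fun d => good_end _ _ d o ((Rel_far_word e).2 nR)).
move: (joint_letter (far_base p r) (far_word p r)) => [i x] ge; case: (c) => j y /= ij;
  subst j.
by rewrite new_actP.2; apply: ge.
Qed.

Lemma joint_supp_core i p : P p -> ~ joint_supp i p.
Proof.
move=> Pp /(joint_supp_address (address_nil Pp))[r [e _]].
have g := half_len_ge e; have lt := half_len_lt e; have [_ /sym_size sr _] := e.
by case=> -[_ /(congr1 size)]; rewrite size_takel ?sr //=; lia.
Qed.

Lemma new_act_core p c : P p -> new_act p c = act p c.
Proof.
move=> Pp.
have [c1|c1] := eqVneq (tagged c) 1%g.
  by rewrite (act_triv new_actP) // (act_triv actP).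
have [Pc|nPc] := pselect (P (act p c)).
  by rewrite new_act_eq //; apply: joint_supp_core.
have -> : act p c = run p (rcons [::] c) by [].
rewrite -new_act_step //; first exact: on_arc_nil.
  by split; [|rewrite reduced1|right].
move=> [r [e /(congr1 size)]]; have g := half_len_ge e; have lt := half_len_lt e.
by have [_ /sym_size sr _] := e; rewrite size_takel ?sr //=; lia.
Qed.

Lemma address_rcons p u (d c : letter) : address act P p (rcons u d) -> tagged c != 1%g ->
  tag d != tag c -> address act P p (rcons (rcons u d) c).
Proof.
move=> [Pp ru out] c1 dc; split=> //; first by rewrite reduced_rcons2 ru c1.
right; case: out => [/(congr1 size)|]; first by rewrite size_rcons.
by rewrite -(cats1 (rcons u d)) takel_cat // size_rcons.
Qed.

Lemma new_core_branch p u c : on_arc p u -> (exists d, tag d =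
    tag c /\ new_address p (rcons u d)) ->
  new_core (new_act (run p u) c).
Proof.
move=> Vu [d [dc nd]]; have [c1|c1] := eqVneq (tagged c) 1%g.
  by rewrite (act_triv new_actP) //; apply: on_arc_new_core.
have [_ nud _] := new_address_step nd.
by apply: new_core_out => //; apply: address_same_tag nud dc c1.
Qed.

Lemma new_core_same p u d c : new_address p (rcons u d) -> tag d = tag c ->
  new_core (new_act (run p (rcons u d)) c).
Proof.
move=> nd dc; have [Vu _ <-] := new_address_step nd.
move: nd dc; case: d => i x; case: c => j y /= nd ij; subst j.
by rewrite new_actP.2; apply: new_core_branch => //; exists (Tagged H x).
Qed.

Lemma new_core_arc p w c : on_arc p w -> new_core (new_act (run p w) c).
Proof.
move=> Vw; have [Pp _] := Vw.
have [c1|c1] := eqVneq (tagged c) 1%g.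
  by rewrite (act_triv new_actP) //; apply: on_arc_new_core.
case/lastP: w Vw => [|w d] Vw.
  have [Pc|nPc] := pselect (P (act p c)).
    by rewrite /= new_act_core //; apply: (on_arc_new_core (on_arc_nil Pc)).
  by apply: new_core_out => //; split; [|rewrite reduced1|right].
have [dc|dc] := eqVneq (tag d) (tag c).
  by apply: new_core_same => //; apply: on_arc_new_address.
by apply: new_core_out => //; apply: address_rcons => //; apply: on_arc_address.
Qed.

Lemma new_address_prefix p w u : new_address p (w ++ u) -> u <> [::] -> on_arc p w.
Proof.
case/lastP: u => // u c; rewrite -rcons_cat => /new_address_step[Vu _ _] _.
exact: on_arc_prefix Vu.
Qed.

Lemma joint_supp_beyond i p w u : new_address p w -> ~ on_arc p w ->
    address act P p (w ++ u) ->
  ~ joint_supp i (run p (w ++ u)).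
Proof.
move=> nw nV nwu /(joint_supp_address nwu)[r [e _ [[Rr eq]|[nR eq]]]]; last first.
  by apply: nV; apply: (@on_arc_prefix _ _ u); rewrite eq; apply: on_arc_exit.
case/lastP: u nwu eq => [|u c] nwu.
  rewrite cats0 take_half_lenS // => eq; move: nw; rewrite eq => -[_ [/(congr1 size)|]].
    by rewrite size_rcons.
  move=> [v [c [/rcons_inj[<- <-] _]]]; apply; exists r; split=> //.
rewrite take_half_lenS // -rcons_cat => /rcons_inj[eq _].
by apply: nV; apply: (@on_arc_prefix _ _ u); rewrite eq; apply: on_arc_exit.
Qed.

Lemma address_prefix p u v : address act P p (u ++ v) -> address act P p u.
Proof.
move=> [Pp /reduced_cat[ru _] out]; split=> //.
by case: u out {ru} => [|a u] /= [] //; [left|left|rewrite !take0; right].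
Qed.

(** No point exchanged at a joint lies on a tree beyond the new core. *)
Lemma run'_beyond p w u : new_address p w -> ~ on_arc p w -> address act P p (w ++ u) ->
  run' (run p w) u = run p (w ++ u).
Proof.
move=> nw nV; elim/last_ind: u => [|u c IH] nwu; first by rewrite cats0.
have nu : address act P p (w ++ u).
  by move: nwu; rewrite -rcons_cat -cats1 => /address_prefix.
rewrite run_rcons IH // -rcons_cat run_rcons; apply: new_act_eq.
  exact: joint_supp_beyond nu.
by rewrite -run_rcons rcons_cat; exact: joint_supp_beyond nwu.
Qed.

Lemma new_core_address p w : address act P p w -> new_core (run p w) -> new_address p w.
Proof. by move=> nw [p' [w' [nw' /(g_inj G nw nw'.1)[-> ->]]]]. Qed.

(** An address over the new core becomes an address over the old one when the
    old address of its base point is prepended. *)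
Lemma new_address_lift q u : address new_act new_core q u -> exists p w,
  [/\ new_address p w, q = run p w, address act P p (w ++ u), run' q u = run p (w ++ u)
    & u = [::] \/ ~ on_arc p w].
Proof.
move=> [[p [w [nw eq]]] ru out]; exists p, w; subst q.
case: u ru out => [_ _|c u ru [//|out]].
  by rewrite cats0; split=> //; [case: nw|left].
have nV : ~ on_arc p w by move=> /(new_core_arc c); move: out; rewrite /= take0.
have nwu : address act P p (w ++ c :: u).
  case/lastP: w nw out nV => [[[Pp _ _] _] _ nV|w d nw out nV].
    by case: nV; apply: on_arc_nil.
  have dc : tag d != tag c.
    by apply/eqP => dc; apply: out; rewrite /= take0; exact: new_core_same.
  have [[Pp rw out'] _] := nw; split=> //; first exact: reduced_rcons_cat.
  by right; case: out' => [/(congr1 size)|];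
    [rewrite size_rcons|rewrite takel_cat ?size_rcons].
by split=> //; [apply: run'_beyond|right].
Qed.

(** The lifted addresses are equal by freeness of the old stage.  They are cut
    at the same place, since a longer cut would place in the new core a point
    that lies beyond it. *)
Lemma new_stage_inj q u q' u' : address new_act new_core q u ->
    address new_act new_core q' u' ->
  run' q u = run' q' u' -> q = q' /\ u = u'.
Proof.
have main w v w2 v2 p : w ++ v = w2 ++ v2 -> new_address p w2 -> v = [::] \/ ~ on_arc p w ->
  size w < size w2 -> False.
  move=> eq nw2 nV lt.
  have ew2 : w2 = w ++ take (size w2 - size w) v.
    have := congr1 (take (size w2)) eq; rewrite [RHS]take_size_cat // => e2.
    by rewrite -[LHS]e2 take_cat ltnNge ltnW.
  case: nV => [v0|nV].
    by have := congr1 size ew2; rewrite v0 take_oversize // cats0 => e;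
      rewrite e ltnn in lt.
  apply: nV; move: nw2; rewrite ew2 => /new_address_prefix; apply => e0.
  by have := congr1 size ew2; rewrite e0 cats0 => e; rewrite e ltnn in lt.
move=> /new_address_lift[p [w [nw -> nwu -> h]]] /new_address_lift[p' [w' [nw' ->
  nwu' -> h']]].
move=> /(g_inj G nwu nwu')[ep eq]; subst p'.
have [lt|lt|es] := ltngtP (size w) (size w').
- by case: (main _ _ _ _ _ eq nw' h lt).
- by case: (main _ _ _ _ _ (esym eq) nw h' lt).
by move/eqP: eq; rewrite eqseq_cat // => /andP[/eqP-> /eqP->].
Qed.

(** A point of the new core that is not on a half arc has only one orbit in the
    new core, the one by which it is attached. *)
Lemma new_core_tag p w (d a : letter) : new_address p (rcons w d) ->
    ~ on_arc p (rcons w d) ->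
  tagged a != 1%g -> new_core (new_act (run p (rcons w d)) a) -> tag d = tag a.
Proof.
move=> nw nV a1; have [//|da] := eqVneq (tag d) (tag a).
have na := address_rcons nw.1 a1 da.
have := run'_beyond (u := [:: a]) nw nV; rewrite cats1 => /(_ na) /= ->
  /(new_core_address na).
by rewrite -cats1 => /new_address_prefix h; case: nV; apply: h.
Qed.

Lemma new_stage_orb q (a b : letter) : new_core q -> tagged a != 1%g -> tag a = tag b ->
  new_core (new_act q a) -> new_core (new_act q b).
Proof.
move=> [p [w [nw ->]]] a1 ab.
have [Vw _|nV] := pselect (on_arc p w); first exact: new_core_arc.
case/lastP: w nw nV => [[[Pp _ _] _] nV|w d nw nV].
  by case: nV; apply: on_arc_nil.
by move=> /(new_core_tag nw nV a1) da; apply: new_core_same; rewrite ?da.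
Qed.

Lemma run'_arc p r s : exits p r -> s <= half_len p r -> run' p (take s r) =
    run p (take s r).
Proof.
move=> e; elim: s => [|s IH] sm; first by rewrite !take0.
have [_ /sym_size sr _] := e; have lt := half_len_lt e.
rewrite (take_nth a0) ?sr; last by lia.
rewrite run_rcons IH; last by lia.
have /on_arc_new_address := on_arc_exit e sm.
by rewrite (take_nth a0) ?sr; [case/new_address_step|lia].
Qed.

Lemma run'_core p w k : (forall s, s < k -> P (run p (take s w))) ->
  run' p (take k w) = run p (take k w).
Proof.
elim: k => [|k IH] inP; first by rewrite !take0.
have [lt|ge] := ltnP k (size w); last first.
  have := IH (fun s lt => inP s (ltnW lt)).
  by rewrite !take_oversize //; lia.
rewrite (take_nth a0) // !run_rcons IH => [|s sk]; last by apply: inP; lia.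
by rewrite new_act_core //; apply: inP.
Qed.

Lemma core_new p : P p -> new_core p.
Proof. by move=> /on_arc_nil/on_arc_new_core. Qed.

(** From [p], the half arc and the joint letter lead to the end of the other
    half arc; the same point is reached by going backwards through the core to
    the far end and then up the other half arc. *)
Lemma exit_closed p r : exits p r -> cell_closed new_act new_core p r.
Proof.
have main q s : exits q s -> Rel s -> cell_closed new_act new_core q s.
  move=> e Rs; have [Pq Rr _] := e; have sr := sym_size Rr.
  have o := exits_far e; have lt := core_len_lt e; have hN := half_len_far e.
  have [[hb _] _] := exit_core_run e.
  have back_run t : t <= core_len q s -> run' q (take t (word_inv s)) =
    run q (take t (word_inv s)).
    by move=> tb; apply: run'_core => u ut; apply: hb; lia.
  have side t : t <= half_len (far_base q s) (far_word q s) ->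
      run' q (take (core_len q s + t) (word_inv s)) =
        run (far_base q s) (take t (far_word q s)).
    move=> tm; rewrite takeD run_cat back_run // -/(far_base q s) -run'_arc //.
    by rewrite /far_word /rot takel_cat // size_drop size_word_inv sr; lia.
  have meet : run' q (take (half_len q s).+1 s) =
    run' q (take (N - (half_len q s).+1) (word_inv s)).
    rewrite take_half_lenS // run_rcons run'_arc // -/(half_end q s) new_act_joint //.
    by rewrite /half_end -side //; congr (run' q (take _ _)); lia.
  have cl : run' q s = q.
    rewrite -{1}(cat_take_drop (half_len q s).+1 s) run_cat meet take_word_inv sr.
    by rewrite subKn ?runVK //; [exact: new_actP|lia].
  split=> // t; have [tm|tm] := leqP t (half_len q s).
    by rewrite run'_arc //; apply: on_arc_new_core; apply: on_arc_exit.
  have [tN|tN] := leqP t N; last first.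
    by rewrite take_oversize ?sr ?cl; [apply: core_new|lia].
  have := run_take_word_inv new_actP cl (s := N - t); rewrite sr subKn // => <-;
    last by lia.
  have [tb|tb] := leqP (N - t) (core_len q s).
    by rewrite back_run //; apply/core_new/hb.
  have -> : N - t = core_len q s + (N - t - core_len q s) by lia.
  rewrite side; last by lia.
  by apply: on_arc_new_core; apply: on_arc_exit; [|lia].
move=> e; have [Rr|nR] := pselect (Rel r); first exact: main.
have [_ R _] := e; have := main _ _ (exits_far e) ((Rel_far_word e).2 nR).
have [[hb _] lt] := exit_core_run e.
have -> : far_base p r = run' p (take (core_len p r) (word_inv r)).
  by rewrite run'_core // => u ub; apply: hb; lia.
move=> /(closed_unrot new_actP) h.
rewrite -(word_invK r); apply: (closed_inv new_actP); apply: h.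
by rewrite size_word_inv sym_size //; rewrite /run_bound in lt; lia.
Qed.

(** Either the relator runs in the old core for so long that it closes there,
    or it exits at some later point, where the cell has been closed. *)
Lemma core_closed p r : P p -> symmetrized r -> cell_closed new_act new_core p r.
Proof.
move=> Pp Rr; have sr := sym_size Rr.
have [all_in|no] := pselect (forall s, s <= run_bound -> P (run p (take s r))).
  have [cl inP] := g_closed G Rr all_in.
  have runE k : run' p (take k r) = run p (take k r).
    by apply: run'_core => s _; apply: inP.
  split=> [|s]; last by rewrite runE; apply/core_new/inP.
  by have := runE (size r); rewrite take_size cl.
have [b [bC [inP out]]] : exists b, b < run_bound /\ ((forall s, s <= b ->
  P (run p (take s r))) /\
    ~ P (run p (take b.+1 r))).
  apply: contrapT => nex; apply: no => s.
  have all_in : forall t, t <= run_bound -> forall u, u <= t -> P (run p (take u r)).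
    elim=> [|t IH] tC u; first by rewrite leqn0 => /eqP->; rewrite take0.
    rewrite leq_eqVlt => /predU1P[->|]; last by rewrite ltnS; apply: IH; lia.
    by apply: contrapT => nP; apply: nex; exists t; split=> //; split=> // v /IH;
      apply; lia.
  by move=> sC; apply: all_in sC _ _.
have bN : b < size r by rewrite sr; rewrite /run_bound in bC; lia.
apply: (closed_unrot new_actP (k := b)); first exact: ltnW.
rewrite run'_core => [|s sb]; last by apply: inP; lia.
apply: exit_closed; split; [exact: inP|exact: sym_rot|].
rewrite -run_cat /rot takel_cat ?size_drop ?subn_gt0 // -takeD addn1.
exact: out.
Qed.

Definition arc_point q := exists p w, on_arc p w /\ q = run p w.

Lemma arc_point_address p w : address act P p w -> arc_point (run p w) -> on_arc p w.
Proof. by move=> nw [p' [w' [Vw' /(g_inj G nw (on_arc_address Vw'))[-> ->]]]]. Qed.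

(** At the top of a half arc the only step in the direction of the joint that
    stays on half arcs is the one across the joint. *)
Lemma end_move p r (c : letter) : exits p r -> tag c = tag (joint_letter p r) ->
    tagged c != 1%g ->
  arc_point (new_act (half_end p r) c) -> c = joint_letter p r.
Proof.
have main q s (d : letter) : exits q s -> Rel s -> tag d = tag (joint_letter q s) ->
  tagged d != 1%g ->
    arc_point (new_act (half_end q s) d) -> d = joint_letter q s.
  move=> e Rs td d1; have [//|dj] := pselect (d = joint_letter q s).
  have nd : address act P q (rcons (take (half_len q s) s) d).
    apply: (@address_same_tag _ _ (joint_letter q s)) => //;
      rewrite -take_half_lenS //; exact: address_take.
  have nr : ~ past_joint q (take (half_len q s) s) d.
    by move=> [s' [e' /(exit_half_uniq e e') <- _ h]]; apply: dj; apply: h.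
  rewrite new_act_step //; last exact: on_arc_exit.
  by move=> /(arc_point_address nd)/(on_arc_end e).
move=> e tc c1; have [Rr|nR] := pselect (Rel r); first exact: main.
have o := exits_far e; have [k1 k2] := farK e.
have := new_act_joint o; rewrite k1 k2 => <-.
have := (fun d => main _ _ d o ((Rel_far_word e).2 nR)); rewrite joint_letter_far //.
move: tc; case: (joint_letter p r) => i x /=; case: c c1 => j y /= y1 ij; subst j.
rewrite new_actP.2 => /(_ (Tagged H (x^-1 * y)%g) erefl) /= h.
have [xy _|xy /(h xy)] := eqVneq (x^-1 * y)%g 1%g.
  by congr Tagged; apply: (mulgI x^-1%g); rewrite xy mulVg.
move=> /eqP; rewrite eq_Tagged /= => /eqP/(congr1 (fun z => x * z)%g).
by rewrite mulgA mulgV mul1g => y0; rewrite y0 eqxx in y1.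
Qed.

(** After more than [M] steps a half arc has no other half arc next to it, so a
    step that does not go on along the arc goes back along it. *)
Lemma deep_move p r s (c : letter) : exits p r -> M < s -> s <= half_len p r ->
  tagged c != 1%g -> tag c != tag (nth a0 r s) ->
  arc_point (new_act (run p (take s r)) c) ->
  c = letter_inv (nth a0 r s.-1) /\ new_act (run p (take s r)) c = run p (take s.-1 r).
Proof.
move=> e Ms sm c1 ctag; have lt := half_len_lt e; have [_ Rr _] := e;
  have sr := sym_size Rr.
case: s Ms sm ctag => // s Ms sm ctag /=.
have Vs := on_arc_exit e sm.
have es : take s.+1 r = rcons (take s r) (nth a0 r s) by rewrite (take_nth a0) // sr; lia.
have Vu : on_arc p (take s r) by apply: on_arc_exit => //; lia.
have szs : size (take s r) = s by rewrite size_takel // sr; lia.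
have on_arc_next d : on_arc p (rcons (take s r) d) -> d = nth a0 r s.
  move=> [_ [/(congr1 size)|]]; first by rewrite size_rcons.
  move=> [r' [s' [e' s0 sm' eqt]]]; have [_ Rr' _] := e'; have lt' := half_len_lt e'.
  have := congr1 size eqt; rewrite size_rcons szs size_takel ?sym_size //; last by lia.
  move=> es'; rewrite -es' (take_nth a0) ?sym_size // in eqt; last by lia.
  have [e1 ->] := rcons_inj eqt.
  by rewrite (@piece_take r r' s).
rewrite es; have [dc|dc] := eqVneq (tag (nth a0 r s)) (tag c).
  have /new_address_step[_ nd <-] : new_address p (rcons (take s r) (nth a0 r s)).
    by rewrite -es; apply: on_arc_new_address.
  move: nd on_arc_next dc; have := on_arc_end; case: (nth a0 r s) => i x.
  case: c c1 ctag => j y /= y1 _ Vend nd on_arc_next ij; subst j.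
  rewrite new_actP.2; have [xy _|xy] := eqVneq (x * y)%g 1%g.
    rewrite xy new_actP.1; split=> //; congr Tagged.
    by apply: (mulgI x); rewrite xy mulgV.
  have nxy : address act P p (rcons (take s r) (Tagged H (x * y)%g)).
    exact: address_same_tag nd _ _.
  rewrite new_act_step //; last first.
    move=> [r' [e' eu _ _]]; move: Vs; rewrite es.
    by rewrite eu => /(on_arc_end e').
  move=> /(arc_point_address nxy)/on_arc_next/eqP; rewrite eq_Tagged /= => /eqP h.
  by case/eqP: y1; apply: (mulgI x); rewrite mulg1.
have nc : address act P p (rcons (rcons (take s r) (nth a0 r s)) c).
  by apply: address_rcons => //; rewrite -es; apply: on_arc_address.
rewrite -es new_act_step ?es //; last first.
- move=> [r' [e' eu tc _]]; case/negP: ctag; apply/eqP.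
  have [_ Rr' _] := e'; have lt' := half_len_lt e'.
  rewrite -?es in eu; have := congr1 size eu; rewrite !size_takel ?sym_size //; try lia.
  move=> em; rewrite -em in eu.
  by rewrite tc /joint_letter -em (@piece_take r r' s.+1) // ltnW.
- by rewrite -es.
move=> /(arc_point_address nc)[_ [/(congr1 size)|]]; first by rewrite size_rcons.
move=> [r' [s' [e' s0 sm' eqt]]]; have [_ Rr' _] := e'; have lt' := half_len_lt e'.
have := congr1 size eqt; rewrite -es size_rcons !size_takel ?sym_size //; try lia.
move=> es'; rewrite -es' (take_nth a0) ?sym_size // in eqt; last by lia.
have [e1 e2] := rcons_inj eqt; case/negP: ctag; apply/eqP.
rewrite e2; congr (tag (nth _ _ _)); apply/esym.
by apply: (@piece_take r r' s.+1) => //; [exact: ltnW|rewrite es].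
Qed.

Lemma nth_tag_neq r k : symmetrized r -> k.+1 < N ->
    tag (nth a0 r k) != tag (nth a0 r k.+1).
Proof. by move=> Rr lt; apply: reduced_tag; [apply: sym_red|rewrite sym_size]. Qed.

Lemma nth_nontriv r k : symmetrized r -> k < N -> tagged (nth a0 r k) != 1%g.
Proof. by move=> Rr lt; apply: reduced_nth; [apply: sym_red|rewrite sym_size]. Qed.

(** The run starts at a point of a half arc by a letter that does not lead back
    towards the core.  Then it climbs.  If it climbs for [M] steps, then its
    relator is the relator of the half arc, and this cell is closed.  Otherwise
    it reaches a joint, crosses it, and by [deep_move] descends for [M] steps
    along the other half arc, with the same conclusion. *)
Lemma upward_closed p u d r : symmetrized r -> on_arc p (rcons u d) ->
    tag d != tag (nth a0 r 0) ->
  (forall s, s <= 2 * M -> arc_point (run' (run p (rcons u d)) (take s r))) ->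
  cell_closed new_act new_core (run p (rcons u d)) r.
Proof.
move=> Rr Vw dr on; have sr := sym_size Rr.
set w := rcons u d in Vw on *; set q := run p w in on *.
pose up j := on_arc p (w ++ take j r) /\ run' q (take j r) = run p (w ++ take j r).
have run_step k : k < N -> run' q (take k.+1 r) = new_act (run' q (take k r)) (nth a0 r k).
  by move=> kN; rewrite (take_nth a0) ?sr // run_rcons.
have [upM|cross] : up M \/ exists i, i < M /\ up i /\ exists r0,
    [/\ exits p r0, w ++ take i r = take (half_len p r0) r0 & nth a0 r i =
      joint_letter p r0].
- suff H_ j : j <= M -> up j \/ exists i, i < M /\ up i /\ exists r0,
    [/\ exits p r0, w ++ take i r = take (half_len p r0) r0 & nth a0 r i =
      joint_letter p r0].
    exact: H_.
  elim: j => [|j IH] jM; first by left; rewrite /up take0 cats0.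
  have [|uj|] := IH; [lia| |by right].
  have [Vj runj] := uj.
  have jN : j < N by lia.
  have ej : take j.+1 r = rcons (take j r) (nth a0 r j) by rewrite (take_nth a0) // sr.
  have nj : address act P p (w ++ take j.+1 r).
    rewrite ej -rcons_cat; have nVj := on_arc_address Vj; have c1 := nth_nontriv Rr jN.
    case: j {IH uj runj ej} jN nVj c1 Vj jM => [|j] jN nVj c1 Vj jM.
      by move: nVj; rewrite take0 cats0 => nVj; apply: address_rcons.
    move: nVj; rewrite (take_nth a0) ?sr; last by lia.
    by rewrite -rcons_cat => nVj; apply: address_rcons => //; apply: nth_tag_neq.
  have onj : arc_point (new_act (run p (w ++ take j r)) (nth a0 r j)).
    by rewrite -runj -run_step //; apply: on; lia.
  have [[r0 [e0 eu tc _]]|nr] := pselect (past_joint p (w ++ take j r) (nth a0 r j)).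
    right; exists j; split; [lia|split=> //]; exists r0; split=> //.
    by apply: end_move => //; [exact: nth_nontriv|rewrite /half_end -eu].
  have step : new_act (run p (w ++ take j r)) (nth a0 r j) = run p (w ++ take j.+1 r).
    by rewrite new_act_step ?rcons_cat -?ej.
  left; split; last by rewrite run_step // runj.
  by apply: arc_point_address => //; rewrite -step.
- have [Vm _] := upM.
  have [Pp [|[r0 [s [e0 s0 sm eqt]]]]] := Vm.
    by move=> /(congr1 size); rewrite size_cat size_rcons.
  have [_ Rr0 _] := e0; have sr0 := sym_size Rr0; have lt0 := half_len_lt e0.
  have szs : size w + M = s.
    by have := congr1 size eqt; rewrite size_cat !size_takel ?sr ?sr0 //; lia.
  have ew : w = take (size w) r0.
    have := congr1 (take (size w)) eqt.
    by rewrite take_size_cat // take_takel //; lia.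
  have er : r = rot (size w) r0.
    apply: (sc_piece SC) => //; first exact: sym_rot.
    rewrite /rot takel_cat; last by rewrite size_drop sr0; lia.
    have := congr1 (drop (size w)) eqt; rewrite drop_size_cat // => ->.
    by rewrite -szs addnC -take_drop.
  rewrite /q {1}ew -run'_arc //; last by lia.
  rewrite er; apply: closed_rot; first by rewrite sr0; lia.
  exact: exit_closed.
have [i [iM [[Vi runi] [r0 [e0 eqi eji]]]]] := cross.
set p1 := far_base p r0; set r1 := far_word p r0; have e1 : exits p1 r1 := exits_far e0.
have [_ R1 _] := e1; have sr1 := sym_size R1; have g1 := half_len_ge e1;
  have lt1 := half_len_lt e1.
have jl1 : joint_letter p1 r1 = letter_inv (nth a0 r i) by rewrite eji joint_letter_far.
have atE : run' q (take i.+1 r) = run p1 (take (half_len p1 r1) r1).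
  by rewrite run_step ?runi ?eqi ?eji -/(half_end p r0) ?new_act_joint //; lia.
clearbody p1 r1.
have down j : j <= M -> run' q (take (i.+1 + j) r) =
  run p1 (take (half_len p1 r1 - j) r1) /\
    forall t, t < j -> nth a0 r (i.+1 + t) = letter_inv (nth a0 r1 (half_len p1 r1 - t).-1).
  elim: j => [|j IH] jM; first by rewrite addn0 subn0.
  have [|runj nthj] := IH; first by lia.
  have onj : arc_point (new_act (run p1 (take (half_len p1 r1 - j) r1)) (nth a0 r (i.+1 + j))).
    by rewrite -runj -run_step -?addnS; [apply: on; lia|lia].
  have [|||||ec er] := @deep_move p1 r1 (half_len p1 r1 - j) (nth a0 r (i.+1 + j)) e1.
  - lia.
  - lia.
  - by apply: nth_nontriv => //; lia.
  - case: j jM {IH onj runj} nthj => [|j] jM nthj.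
      rewrite subn0 -/(joint_letter p1 r1) jl1 addn0 eq_sym.
      by apply: nth_tag_neq => //; lia.
    have := nthj j (ltnSn j).
    have -> : (half_len p1 r1 - j).-1 = half_len p1 r1 - j.+1 by lia.
    move=> h; rewrite -(letter_invK (nth a0 r1 _)) -h.
    by rewrite eq_sym addnS; apply: nth_tag_neq => //; lia.
  - exact: onj.
  rewrite addnS run_step ?runj ?er; last by lia.
  split; first by congr (run p1 (take _ r1)); lia.
  move=> t; rewrite ltnS leq_eqVlt => /predU1P[-> //|tj]; exact: nthj.
have eqr : rot i.+1 r = word_inv (rot (half_len p1 r1) r1).
  apply: (sc_piece SC); [exact: sym_rot|by apply/sym_inv/sym_rot|].
  apply: (@eq_from_nth _ a0).
    by rewrite !size_takel ?size_word_inv ?size_rot ?sr ?sr1 //; lia.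
  move=> t; rewrite size_takel ?size_rot ?sr; last by lia.
  move=> tM; rewrite !nth_take // /rot nth_cat size_drop sr ifT; last by lia.
  rewrite nth_drop /word_inv nth_rev ?size_map -/(rot _ r1) ?size_rot ?sr1; last by lia.
  rewrite (nth_map a0) ?size_rot ?sr1; last by lia.
  have [_ ->] := down M (leqnn _); last by [].
  congr letter_inv; rewrite /rot nth_cat size_drop sr1 ifF; last by lia.
  by rewrite nth_take; [congr nth; lia|lia].
apply: (closed_unrot new_actP (k := i.+1)); first by rewrite sr; lia.
rewrite atE eqr; apply: (closed_inv new_actP).
rewrite -run'_arc //; apply: closed_rot; first by rewrite sr1; lia.
exact: exit_closed.
Qed.

(** If the run meets the old core, [core_closed] applies.  Otherwise its
    interior points are on half arcs, because both neighbours are in the new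
    core, along different factors.  At the middle of the run, one of the two
    directions does not lead back towards the core, and [upward_closed] applies
    to the run or to the reversed run. *)
Lemma new_stage_closed q r : symmetrized r ->
  (forall s, s <= run_bound -> new_core (run' q (take s r))) ->
    cell_closed new_act new_core q r.
Proof.
move=> Rr inP; have sr := sym_size Rr.
have [[s [sC Ps]]|noP] := pselect (exists s, s <= run_bound /\ P (run' q (take s r))).
  apply: (closed_unrot new_actP (k := s)); first by rewrite sr;
    rewrite /run_bound in sC; lia.
  by apply: core_closed => //; apply: sym_rot.
have onVs s : 0 < s -> s < run_bound -> exists p u d,
    on_arc p (rcons u d) /\ run' q (take s r) = run p (rcons u d).
  move=> s0 sC; have [p [w [nw eq]]] := inP s (ltnW sC).
  case/lastP: w nw eq => [|u d] nw eq.
    by case: noP; exists s; split; [exact: ltnW|rewrite eq; have [[]] := nw].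
  exists p, u, d; split=> //; apply: contrapT => nV.
  rewrite /run_bound in sC.
  have sN : s < N by lia.
  have next : new_core (new_act (run p (rcons u d)) (nth a0 r s)).
    have := inP s.+1; rewrite (take_nth a0) ?sr // run_rcons eq; apply;
      rewrite /run_bound; lia.
  have prev : new_core (new_act (run p (rcons u d)) (letter_inv (nth a0 r s.-1))).
    have es : take s r = rcons (take s.-1 r) (nth a0 r s.-1).
      by rewrite -take_nth ?prednK // sr; lia.
    by rewrite -eq es run_rcons (actK new_actP); apply: inP; rewrite /run_bound; lia.
  have n1 := nth_nontriv Rr sN.
  have n2 : tagged (letter_inv (nth a0 r s.-1)) != 1%g.
    by rewrite /= invg_eq1; apply: nth_nontriv => //; lia.
  have t1 := new_core_tag nw nV n1 next; have t2 := new_core_tag nw nV n2 prev.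
  have := @nth_tag_neq r s.-1 Rr; rewrite prednK // => /(_ sN).
  by rewrite -t1 t2 eqxx.
pose m := (2 * M).+1.
have mr : m <= size r by rewrite sr /m; lia.
apply: (closed_unrot new_actP mr).
have [||p [u [d [Vw eq]]]] := onVs m; rewrite /run_bound /m; try lia.
rewrite -/m eq; have [dn|dn] := eqVneq (tag d) (tag (nth a0 r m)); last first.
  apply: upward_closed => //; first exact: sym_rot.
    by rewrite /rot nth_cat size_drop sr ifT ?nth_drop ?addn0 // /m; lia.
  move=> s sM; rewrite -eq -run_cat /rot takel_cat; last by rewrite size_drop sr /m; lia.
  rewrite -takeD; have [||p' [u' [d' [V' ->]]]] := onVs (m + s); rewrite /run_bound /m;
    try lia.
  by exists p', (rcons u' d').
have nthm : nth a0 (word_inv (rot m r)) 0 = letter_inv (nth a0 r (2 * M)).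
  rewrite /word_inv nth_rev ?size_map ?size_rot ?sr; last by lia.
  rewrite (nth_map a0) ?size_rot ?sr; last by lia.
  by rewrite /rot nth_cat size_drop sr ifF ?nth_take;
    [congr (letter_inv (nth _ _ _))| |]; rewrite /m; lia.
rewrite -(word_invK (rot m r)); apply: (closed_inv new_actP).
apply: upward_closed => //; first by apply/sym_inv/sym_rot.
  by rewrite nthm dn eq_sym /=; apply: nth_tag_neq => //; lia.
move=> s sM; rewrite -eq.
have -> : take s (word_inv (rot m r)) = word_inv (drop (m - s) (take m r)).
  rewrite take_word_inv /rot size_cat size_drop size_take_min; congr word_inv.
  rewrite drop_cat size_drop ifF; last by rewrite /m sr; lia.
  by congr drop; rewrite sr /m; lia.
rewrite -{1}(cat_take_drop (m - s) (take m r)) run_cat (runK new_actP) take_takel;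
  last by lia.
have [||p' [u' [d' [V' ->]]]] := onVs (m - s); rewrite /run_bound /m; try lia.
by exists p', (rcons u' d').
Qed.

Theorem new_stage : good_stage new_act new_core.
Proof.
split; [exact: new_actP|exact: new_stage_inj|exact: new_stage_orb|exact: new_stage_closed].
Qed.

End Step.

Lemma next_stage (Om : Type) (act : Om -> letter -> Om) (P : set Om) : good_stage act P ->
  exists ap : (Om -> letter -> Om) * set Om, [/\ good_stage ap.1 ap.2,
    forall p c, P p -> ap.1 p c = act p c, (P `<=` ap.2)%classic,
    forall p c, P p -> ap.2 (act p c) &
    forall p r, P p -> symmetrized r -> cell_closed ap.1 ap.2 p r].
Proof.
move=> G; exists (new_act G, new_core act P); split=> /=.
- exact: new_stage.
- by move=> p c Pp; apply: new_act_core.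
- by move=> p Pp; apply: (core_new G).
- by move=> p c Pp; rewrite -(new_act_core G) //;
  apply: (new_core_arc G c (on_arc_nil _ Pp)).
- by move=> p r Pp Rr; apply: (core_closed G).
Qed.

Lemma first_stage : good_stage (@free_act I H) [set @free_base I H]%classic.
Proof.
have act_base (a : letter) : tagged a != 1%g -> free_act (free_base H) a <> free_base H.
  by move=> a1 /(congr1 sval); rewrite /= push_neq.
split; first exact: free_actP.
- by move=> p w p' w' [-> rw _] [-> rw' _] /(run_free_base_inj rw rw') ->.
- by move=> p a b -> a1 _ /(act_base _ a1).
move=> p r Rr inP; have p0 := inP 0 (leq0n _); rewrite take0 /= in p0.
have C1 : 1 <= run_bound by rewrite /run_bound; lia.
have := inP 1 C1; rewrite p0.
have := sym_red Rr; have := sym_size Rr; case: (r) => [|a u] /=; first by lia.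
by rewrite take0 /= => _ /andP[/andP[a1 _] _] /(act_base _ a1).
Qed.

(** The union of the cores of a tower of stages.  Each action agrees with the
    next one on the current core, so the actions have a limit there; outside
    the union every letter is made to act trivially. *)
Theorem small_cancellation_action : exists (X : Type) (act : X -> letter -> X) (x0 : X),
  [/\ is_action act, forall x r, Rel r -> run_word act x r = x &
      forall a : letter, tagged a != 1%g -> act x0 a <> x0].
Proof.
pose Om := @free_pt I H.
pose stage := {ap : (Om -> letter -> Om) * set Om | good_stage ap.1 ap.2}.
have next_ex (ap : stage) : exists ap' : stage,
   [/\ forall p c, (sval ap).2 p -> (sval ap').1 p c = (sval ap).1 p c,
    ((sval ap).2 `<=` (sval ap').2)%classic,
    forall p c, (sval ap).2 p -> (sval ap').2 ((sval ap).1 p c) &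
    forall p r, (sval ap).2 p -> symmetrized r ->
      cell_closed (sval ap').1 (sval ap').2 p r].
  by have [ap' [g h1 h2 h3 h4]] := next_stage (svalP ap); exists (exist _ ap' g).
have [next nextP] := choice next_ex.
pose st n : stage := iter n next (exist _ (_, _) first_stage).
pose A n := (sval (st n)).1; pose P n := (sval (st n)).2.
have AS n p c : P n p -> A n.+1 p c = A n p c by have [h _ _ _] := nextP (st n); apply: h.
have PS n p : P n p -> P n.+1 p by have [_ h _ _] := nextP (st n); apply: h.
have PA n p c : P n p -> P n.+1 (A n p c) by have [_ _ h _] := nextP (st n); apply: h.
have PR n p r : P n p -> symmetrized r -> cell_closed (A n.+1) (P n.+1) p r.
  by have [_ _ _ h] := nextP (st n); apply: h.
have Ple n m p : n <= m -> P n p -> P m p.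
  by move=> /subnK <- Pn; elim: (m - n) => // k IH; rewrite addSn; apply: PS.
have Ale n m p c : n <= m -> P n p -> A m p c = A n p c.
  move=> /subnK <- Pn; elim: (m - n) => // k IH; rewrite addSn AS //.
  by apply: Ple Pn; rewrite leq_addl.
have Aact n : is_action (A n) := g_act (svalP (st n)).
pose Q p := exists n, P n p.
pose lev p := xget 0 [set n | P n p]%classic.
have levP p : Q p -> P (lev p) p by move=> Qp; exact: (xgetPex 0 Qp).
pose act p c := if `[< Q p >] then A (lev p) p c else p.
have actE n p c : P n p -> act p c = A n p c.
  move=> Pn; have Qp : Q p by exists n.
  rewrite /act asboolT // -(Ale _ (maxn (lev p) n)) ?leq_maxl; [|by []|exact: levP].
  by apply: Ale => //; rewrite leq_maxr.
have actN p c : ~ Q p -> act p c = p by move=> nQ; rewrite /act asboolF.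
have runN p w : ~ Q p -> run_word act p w = p.
  by move=> nQ; elim: w => //= a w IH; rewrite actN.
exists Om, act, (free_base H); split.
- split=> [p i|p i x y]; have [[n Pn]|nQ] := pselect (Q p);
    [|by rewrite actN| |by rewrite !actN].
    by rewrite (actE n) //; apply: (Aact n).1.
  rewrite !(actE n p _ Pn) (actE n.+1); last exact: PA.
  by rewrite -!(AS n p _ Pn) (Aact n.+1).2.
- move=> p r Rr; have [[n Pn]|/runN//] := pselect (Q p).
  have [cl inP] := PR _ _ _ Pn (or_introl Rr).
  suff runE k : run_word act p (take k r) = run_word (A n.+1) p (take k r).
    by have := runE (size r); rewrite take_size cl.
  elim: k => [|k IH]; first by rewrite !take0.
  have [lt|ge] := ltnP k (size r); last by move: IH; rewrite !take_oversize // ltnW.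
  by rewrite (take_nth a0) // !run_rcons IH (actE n.+1).
move=> a a1; have P0 : P 0 (free_base H) by [].
by rewrite (actE 0) // => /(congr1 sval); rewrite /= push_neq.
Qed.

End Tower.

(** * The relators *)

Section Relators.
Variables (I : choiceType) (H : I -> groupType).
Local Notation letter := {i : I & H i}.
Local Notation word := (seq letter).
Variables (big : I -> Prop) (y : forall e, letter -> letter -> nat -> H e).
Hypothesis y1 : forall e a b k, big e -> y e a b k != 1%g.
Hypothesis y_inj : forall e a b k a' b' k', big e ->
  y e a b k = y e a' b' k' \/ y e a b k = (y e a' b' k')^-1%g ->
  [/\ a = a', b = b' & k = k'].

(** Pieces are shorter than three blocks of six letters.  Then the length has to
    be at least 8 * 18 + 4, and 149 = 1 + 4 * 37 is the least such length for
    relators made of one letter and of quadruples y a y^-1 a. *)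
Definition rel_len := 149.
Definition rel_piece := 18.
Local Notation N := rel_len.

Definition y_letter e a b k : letter := Tagged H (y e a b k).
(** The letters of a relator at odd positions; each [y] is followed by its
    inverse, so that the relator becomes trivial when [a] does, whatever the
    group [H e] is. *)
Definition y_pattern e a b m := if odd m then letter_inv (y_letter e a b m./2) else y_letter e a b m./2.
Definition rel_nth e (a b : letter) p : letter :=
  if p == 0 then letter_inv b else if odd p then y_pattern e a b p./2 else a.
Definition relator e a b : word := mkseq (rel_nth e a b) N.

Definition relator_index e (a b : letter) :=
  [/\ big e, tagged a != 1%g, tagged b != 1%g & [/\ tag a != e, tag b != e &
    tag a != tag b]].

Definition relators : set word := [set r | exists e a b s,
  relator_index e a b /\ r = rot s (relator e a b)]%classic.

Lemma size_relator e a b : size (relator e a b) = N.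
Proof. by rewrite size_mkseq. Qed.

Lemma tag_y_pattern e a b m : tag (y_pattern e a b m) = e.
Proof. by rewrite /y_pattern; case: ifP. Qed.

Lemma tag_rel_nth e a b p : tag (rel_nth e a b p) =
  if p == 0 then tag b else if odd p then e else tag a.
Proof. by rewrite /rel_nth; case: ifP => // _; case: ifP => //; rewrite tag_y_pattern. Qed.

Lemma rel_nth1 e a b p : relator_index e a b -> tagged (rel_nth e a b p) != 1%g.
Proof.
move=> [be a1 b1 _]; rewrite /rel_nth; case: ifP => _; first by rewrite /= invg_eq1.
case: ifP => // _; rewrite /y_pattern; case: ifP => _ /=; last exact: y1.
by rewrite invg_eq1; apply: y1.
Qed.

Lemma reduced_relator e a b : relator_index e a b -> reduced (relator e a b).
Proof.
move=> v; have [_ a1 b1 [ae be ab]] := v.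
apply/andP; split.
  by apply/(all_nthP a) => i; rewrite size_mkseq => lt; rewrite nth_mkseq //;
    apply: rel_nth1.
apply/(sortedP a) => i; rewrite size_mkseq => lt.
rewrite !nth_mkseq // ?(ltnW lt) // !tag_rel_nth /=.
case: i {lt} => [|i] //=; by case: (odd i) => //=; rewrite eq_sym.
Qed.

Lemma reduced_rot_relator e a b s : relator_index e a b -> reduced (rot s (relator e a b)).
Proof.
move=> v; have [_ a1 b1 [ae be ab]] := v; have rr := reduced_relator v.
have [le|gt] := leqP s (size (relator e a b)); last by rewrite rot_oversize // ltnW.
have : reduced (relator e a b ++ relator e a b).
  have e1 : relator e a b = rcons (mkseq (rel_nth e a b) N.-1) (rel_nth e a b N.-1).
    by rewrite -mkseqS.
  have e2 : relator e a b = rel_nth e a b 0 :: behead (relator e a b) by [].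
  rewrite {1}e1 e2; apply: reduced_rcons_cat; [by rewrite -e1|by rewrite -e2|].
  by rewrite !tag_rel_nth.
move: (relator e a b) => x; have -> : x ++ x = take s x ++ (rot s x ++ drop s x).
  by rewrite /rot -catA cat_take_drop catA cat_take_drop.
by move=> /reduced_cat[_ /reduced_cat[]].
Qed.

Lemma nth_rot_relator c e a b s k : s < N -> k < N ->
  nth c (rot s (relator e a b)) k =
  rel_nth e a b (if s + k < N then s + k else s + k - N).
Proof.
move=> sN kN; rewrite /rot nth_cat size_drop size_relator ltn_subRL.
case: ltnP => h; first by rewrite nth_drop nth_mkseq.
rewrite nth_take; last by lia.
rewrite nth_mkseq; last by lia.
by congr rel_nth; lia.
Qed.

Lemma rot_relator e a b s : exists2 s', s' < N & rot s (relator e a b) =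
    rot s' (relator e a b).
Proof.
have [lt|ge] := ltnP s N; first by exists s.
by exists 0 => //; rewrite rot0 rot_oversize // size_relator.
Qed.

(** Only the index [m./2] of a letter can be read off, as a letter and its
    inverse may be equal. *)
Lemma y_pattern_inj e a b m e' a' b' m' : big e ->
  (y_pattern e a b m = y_pattern e' a' b' m' \/ y_pattern e a b m =
    letter_inv (y_pattern e' a' b' m')) ->
  [/\ e = e', a = a', b = b' & m./2 = m'./2].
Proof.
move=> be h.
have ee : e = e'.
  by case: h => /(congr1 (fun c : letter => tag c)) /=; rewrite !tag_y_pattern.
subst e'; suff [-> -> ->] : [/\ a = a', b = b' & m./2 = m'./2] by [].
apply: (y_inj be); rewrite /y_pattern in h.
by move: h; case: (odd m); case: (odd m'); rewrite ?letter_invK => -[] /eqP;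
  rewrite eq_Tagged /= => /eqP h; do ?[move: h => /invg_inj h];
  try (by left); try (by right); move: h => /(congr1 (fun x => x^-1)%g);
    rewrite !invgK => h;
  try (by left); right.
Qed.

Lemma y_pattern_nonconst e a b m c : big e -> y_pattern e a b m = c ->
    y_pattern e a b m.+2 = c -> False.
Proof.
move=> be h1 h2; have := @y_pattern_inj e a b m e a b m.+2 be; rewrite h1 h2.
by case; [left|move=> _ _ _ /=; lia].
Qed.

Lemma rel_nth_odd e a b m : rel_nth e a b m.*2.+1 = y_pattern e a b m.
Proof. by rewrite /rel_nth /= odd_double /= uphalf_double. Qed.

Lemma rel_nth_even e a b m : 0 < m -> rel_nth e a b m.*2 = a.
Proof. by rewrite /rel_nth double_eq0 odd_double; case: m. Qed.

Lemma odd_in_window u : exists m i, i <= 1 /\ u + i = m.*2.+1.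
Proof.
by have := odd_double_half u; case: (odd u) => /= h; [exists u./2, 0|exists u./2, 1]; lia.
Qed.

(** Six consecutive letters contain three letters of the pattern.  If the
    windows are out of phase, all three are the letter [a'] of the other
    relator, which is impossible for letters of different indices.  If they are
    in phase, the successive indices determine the position. *)
Lemma window_forward e a b e' a' b' u u' : relator_index e a b ->
    relator_index e' a' b' -> 0 < u -> 0 < u' ->
  (forall i, i < 6 -> rel_nth e a b (u + i) = rel_nth e' a' b' (u' + i)) ->
  [/\ e = e', a = a', b = b' & u = u'].
Proof.
move=> [be _ _ _] _ u0 u0' eqw; have [m [i [i1 em]]] := odd_in_window u.
have Yat k : k <= 2 -> y_pattern e a b (m + k) = rel_nth e' a' b' (u' + i + k.*2).
  by move=> k2; rewrite -rel_nth_odd -addnA -eqw; [congr rel_nth; lia|lia].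
have := odd_double_half (u' + i); case: (odd _) => /= em'.
  have Y2 k : k <= 2 -> y_pattern e a b (m + k) = y_pattern e' a' b' ((u' + i)./2 + k).
    by move=> k2; rewrite Yat // -rel_nth_odd; congr rel_nth; lia.
  have [|ee ea eb h0] := y_pattern_inj be (or_introl (Y2 0 _)); first by [].
  have [|_ _ _ h1] := y_pattern_inj be (or_introl (Y2 1 _)); first by [].
  by split=> //; lia.
have Y2 k : k <= 2 -> y_pattern e a b (m + k) = a'.
  move=> k2; rewrite Yat // -[RHS](@rel_nth_even e' a' b' ((u' + i)./2 + k)); last by lia.
  by congr rel_nth; lia.
by case: (@y_pattern_nonconst e a b m a' be);
  [rewrite -{1}(Y2 0) ?addn0|rewrite -{1}(Y2 2) ?addn2].
Qed.

(** In phase, the indices increase along one window and decrease along the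
    other. *)
Lemma window_backward e a b e' a' b' u v : relator_index e a b ->
    relator_index e' a' b' -> 0 < u -> 5 < v ->
  (forall i, i < 6 -> rel_nth e a b (u + i) = letter_inv (rel_nth e' a' b' (v - i))) ->
    False.
Proof.
move=> [be _ _ _] _ u0 v5 eqw; have [m [i [i1 em]]] := odd_in_window u.
have Yat k : k <= 2 -> y_pattern e a b (m + k) =
  letter_inv (rel_nth e' a' b' (v - i - k.*2)).
  by move=> k2; rewrite -rel_nth_odd -subnDA -eqw; [congr rel_nth; lia|lia].
have := odd_double_half (v - i); case: (odd _) => /= em'.
  have Y2 k : k <= 2 -> y_pattern e a b (m + k) =
    letter_inv (y_pattern e' a' b' ((v - i)./2 - k)).
    by move=> k2; rewrite Yat // -rel_nth_odd; congr (letter_inv (rel_nth _ _ _ _)); lia.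
  have [|_ _ _ h0] := y_pattern_inj be (or_intror (Y2 0 _)); first by [].
  have [|_ _ _ h1] := y_pattern_inj be (or_intror (Y2 2 _)); first by [].
  lia.
have Y2 k : k <= 2 -> y_pattern e a b (m + k) = letter_inv a'.
  move=> k2; rewrite Yat // -[in RHS](@rel_nth_even e' a' b' ((v - i)./2 - k)); last by lia.
  by congr (letter_inv (rel_nth _ _ _ _)); lia.
by apply: (@y_pattern_nonconst e a b m (letter_inv a') be);
  [rewrite -{1}(Y2 0) ?addn0|rewrite -{1}(Y2 2) ?addn2].
Qed.

Definition cyc_pos s k := if s + k < N then s + k else s + k - N.

(** The [g]-th block of six letters of the relator rotated by [s] does not
    contain the position 0, which holds the letter without pattern. *)
Definition clean s g := (0 < s + 6 * g) && (s + 6 * g + 5 < N) || (N < s + 6 * g).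

Lemma clean_window s g : s < N -> g <= 2 -> clean s g -> exists2 u,
  0 < u /\ u = cyc_pos s (6 * g) & forall i, i < 6 -> cyc_pos s (6 * g + i) = u + i.
Proof.
rewrite /clean /cyc_pos /N => sN g2 cl; have {}cl :
  (0 < s + 6 * g /\ s + 6 * g + 5 < 149) \/ 149 < s + 6 * g.
  by move: cl => /orP[/andP[]|]; [left|right].
exists (if s + 6 * g < 149 then s + 6 * g else s + 6 * g - 149).
  by split=> //; case: (ltnP (s + 6 * g)) => h1; lia.
by move=> i i6; case: (ltnP (s + (6 * g + i))) => h1; case: (ltnP (s + 6 * g)) => h2; lia.
Qed.

(** Each of the two relators spoils at most one of the three blocks. *)
Lemma clean_ex s s' : s < N -> s' < N -> exists g, [/\ g <= 2, clean s g & clean s' g].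
Proof.
rewrite /clean /N => sN sN'.
case: (boolP (clean s 0 && clean s' 0)) => [/andP[]|]; rewrite /clean /N.
  by exists 0.
case: (boolP (clean s 1 && clean s' 1)) => [/andP[]|]; rewrite /clean /N.
  by exists 1.
by exists 2; split; lia.
Qed.

(** The same for the blocks counted backwards from the end. *)
Definition clean' s g := (s < 6 * g + 1) || (6 * g + 6 < s).

Lemma clean_window' s g : s < N -> g <= 2 -> clean' s g -> exists2 v,
  5 < v & forall i, i < 6 -> cyc_pos s (N.-1 - (6 * g + i)) = v - i.
Proof.
rewrite /clean' /cyc_pos /N => sN g2 cl.
have {}cl : s < 6 * g + 1 \/ 6 * g + 6 < s by case/orP: cl; [left|right].
exists (if s < 6 * g + 1 then s + (148 - 6 * g) else s + (148 - 6 * g) - 149).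
  by case: (ltnP s (6 * g + 1)) => h1; lia.
move=> i i6; case: (ltnP (s + (149.-1 - (6 * g + i)))) => h1;
  case: (ltnP s (6 * g + 1)) => h2; lia.
Qed.

Lemma clean_ex' s s' : s < N -> s' < N -> exists g, [/\ g <= 2, clean s g & clean' s' g].
Proof.
rewrite /clean /clean' /N => sN sN'.
case: (boolP (clean s 0 && clean' s' 0)) => [/andP[]|]; rewrite /clean /clean' /N.
  by exists 0.
case: (boolP (clean s 1 && clean' s' 1)) => [/andP[]|]; rewrite /clean /clean' /N.
  by exists 1.
by exists 2; split; lia.
Qed.

Lemma relators_forward r r' : relators r -> relators r' ->
  take rel_piece r = take rel_piece r' -> r = r'.
Proof.
move=> [e [a [b [s0 [v ->]]]]] [e' [a' [b' [s0' [v' ->]]]]].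
have [s sN ->] := rot_relator e a b s0; have [s' sN' ->] := rot_relator e' a' b' s0'.
move=> eqt.
have eqn k : k < rel_piece -> rel_nth e a b (cyc_pos s k) = rel_nth e' a' b' (cyc_pos s' k).
  move=> kM; have kN : k < N by apply: leq_trans kM _.
  by rewrite -!(nth_rot_relator a) // -(nth_take _ kM) eqt nth_take.
have [g [g2 cl cl']] := clean_ex sN sN'.
have [u [u0 eu] un] := clean_window sN g2 cl;
  have [u' [u0' eu'] un'] := clean_window sN' g2 cl'.
have [i i6|-> -> -> uu] := window_forward v v' u0 u0'.
  by rewrite -un // -un' //; apply: eqn; rewrite /rel_piece; lia.
suff -> : s = s' by [].
move: eu; rewrite uu eu' /cyc_pos /N.
rewrite /N in sN sN' *.
by case: (ltnP (s + 6 * g)) => h1; case: (ltnP (s' + 6 * g)) => h2; lia.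
Qed.

Lemma relators_backward r r' : relators r -> relators r' ->
  take rel_piece r <> take rel_piece (word_inv r').
Proof.
move=> [e [a [b [s0 [v ->]]]]] [e' [a' [b' [s0' [v' ->]]]]].
have [s sN ->] := rot_relator e a b s0; have [s' sN' ->] := rot_relator e' a' b' s0'.
move=> eqt.
have eqn k : k < rel_piece ->
    rel_nth e a b (cyc_pos s k) = letter_inv (rel_nth e' a' b' (cyc_pos s' (N.-1 - k))).
  move=> kM; have kN : k < N by apply: leq_trans kM _.
  rewrite -(nth_rot_relator a) // -(nth_take _ kM) eqt nth_take //.
  rewrite /word_inv nth_rev ?size_map ?size_rot ?size_relator //.
  rewrite (nth_map a) ?size_rot ?size_relator; last by rewrite /N; lia.
  rewrite nth_rot_relator //; last by rewrite /N; lia.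
have [g [g2 cl cl']] := clean_ex' sN sN'.
have [u [u0 _] un] := clean_window sN g2 cl; have [w w5 wn] := clean_window' sN' g2 cl'.
apply: (window_backward v v' u0 w5) => i i6.
by rewrite -un // -wn //; apply: eqn; rewrite /rel_piece; lia.
Qed.

Lemma relators_rot r k : relators r -> relators (rot k r).
Proof.
move=> [e [a [b [s0 [v ->]]]]]; have [s sN ->] := rot_relator e a b s0.
have [le|gt] := leqP k N; last first.
  by rewrite (rot_oversize (n := k)) ?size_rot ?size_relator ?(ltnW gt) //; exists e,
    a, b, s.
rewrite rot_add_mod ?size_relator ?(ltnW sN) //.
by exists e, a, b, (if k + s <= N then k + s else k + s - N).
Qed.

Theorem relators_sc : small_cancellation relators rel_len rel_piece.
Proof.
split.
- by move=> r [e [a [b [s [v ->]]]]]; rewrite size_rot size_relator.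
- by move=> r [e [a [b [s [v ->]]]]]; apply: reduced_rot_relator.
- exact: relators_rot.
- by move=> r Rr Rr'; case: (relators_backward Rr Rr'); rewrite word_invK.
move=> r r' [Rr|Rr] [Rr'|Rr'] eqt; first exact: relators_forward.
- by case: (relators_backward Rr Rr'); rewrite word_invK.
- by case: (relators_backward Rr' Rr); rewrite word_invK.
have size_rel x : relators x -> size x = N by case=> ? [? [? [? [_ ->]]]];
  rewrite size_rot size_relator.
have sr : size r = N by rewrite -(size_word_inv r) size_rel.
have sr' : size r' = N by rewrite -(size_word_inv r') size_rel.
have tail (x : word) : size x = N ->
    take rel_piece (rot (N - rel_piece) (word_inv x)) = word_inv (take rel_piece x).
  move=> sx; rewrite /rot takel_cat ?size_drop ?size_word_inv ?sx //.
  by rewrite drop_word_inv sx subKn // take_oversize // size_word_inv size_takel // sx.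
have eqr : rot (N - rel_piece) (word_inv r) = rot (N - rel_piece) (word_inv r').
  by apply: relators_forward; rewrite ?tail ?eqt //; exact: relators_rot.
by move/rot_inj: eqr => /(can_inj (@word_invK _ _)).
Qed.

End Relators.

(** * Simple quotients *)

Section Quotient.
Local Open Scope classical_set_scope.
Variables (I : choiceType) (H : I -> groupType).
Local Notation letter := {i : I & H i}.
Local Notation word := (seq letter).

(** The words that represent 1 in a quotient group of the free product.
    Closure under insertion and deletion of members replaces closure under
    products, inverses, conjugation and free reduction. *)
Record kernel (K : set word) : Prop := Kernel {
  ker_nil : K [::];
  ker_indel : forall u k v, K k -> K (u ++ k ++ v) <-> K (u ++ v);
  ker_inv : forall a, K [:: a; letter_inv a];
  ker_mul : forall i (x y : H i),
    K [:: Tagged H x; Tagged H y; letter_inv (Tagged H (x * y)%g)] }.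

Section OneKernel.
Variable K : set word.
Hypothesis kK : kernel K.

Lemma kernel_word_inv w : K (w ++ word_inv w).
Proof.
elim/last_ind: w => [|w c IH]; first exact: (ker_nil kK).
have -> : rcons w c ++ word_inv (rcons w c) = w ++ [:: c; letter_inv c] ++ word_inv w.
  by rewrite word_inv_rcons -cats1 -catA.
by apply/(ker_indel kK) => //; exact: (ker_inv kK).
Qed.

Lemma kernel_Vw w : K (word_inv w ++ w).
Proof. by rewrite -{2}(word_invK w); exact: kernel_word_inv. Qed.

Lemma kernel_inv u : K u -> K (word_inv u).
Proof. by move=> Ku; have := kernel_word_inv u; rewrite -{1}[u]cat0s -catA =>
  /(ker_indel kK _ _ Ku). Qed.

Lemma kernel_cat u v : K u -> K v -> K (u ++ v).
Proof. by move=> Ku Kv; rewrite -[u ++ v]cat0s; apply/(ker_indel kK). Qed.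

Lemma kernel_del u v w : K (u ++ v) -> K (word_inv v ++ w) -> K (u ++ w).
Proof.
move=> K1 K2; have := kernel_cat K1 K2; rewrite -catA (catA v).
by move/(ker_indel kK _ _ (kernel_word_inv v)).
Qed.

Lemma kernel_rotate u v : K (u ++ v) -> K (v ++ u).
Proof.
move=> Kuv; have Kc : K (v ++ (u ++ v) ++ word_inv v).
  by apply/(ker_indel kK) => //; exact: kernel_word_inv.
move: Kc; rewrite -!catA catA -{1}[v ++ word_inv v]cats0 =>
  /(ker_indel kK _ _ (kernel_word_inv v)).
by rewrite cats0.
Qed.

Definition weq : rel word := fun u v => `[< K (u ++ word_inv v) >].

Lemma weq_refl : reflexive weq.
Proof. by move=> u; apply/asboolP; exact: kernel_word_inv. Qed.

Lemma weq_sym : symmetric weq.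
Proof.
by move=> u v; apply/asboolP/asboolP => /kernel_inv; rewrite word_inv_cat word_invK.
Qed.

Lemma weq_trans : transitive weq.
Proof.
move=> v u w /asboolP K1 /asboolP K2; apply/asboolP.
by apply: kernel_del K1 _; rewrite word_invK.
Qed.

Canonical weq_equiv := EquivRel weq weq_refl weq_sym weq_trans.

Local Open Scope quotient_scope.
Definition wquot := {eq_quot weq}.
HB.instance Definition _ := Choice.on wquot.

Definition wcl (u : word) : wquot := \pi_({eq_quot weq}) u.

Lemma wcl_eq u v : wcl u = wcl v <-> K (u ++ word_inv v).
Proof.
split=> [/eqmodP h|Kuv]; first by move: h; rewrite /= => /asboolP.
by rewrite /wcl; apply/eqmodP; exact/asboolP.
Qed.

Lemma wcl_repr (s : wquot) : wcl (repr s) = s.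
Proof. exact: reprK. Qed.

Definition wmul (s t : wquot) : wquot := wcl (repr s ++ repr t).
Definition wquot_inv (s : wquot) : wquot := wcl (word_inv (repr s)).

Lemma wmulE u v : wmul (wcl u) (wcl v) = wcl (u ++ v).
Proof.
apply/wcl_eq; have := (wcl_eq (repr (wcl u)) u).1 (wcl_repr _).
have := (wcl_eq (repr (wcl v)) v).1 (wcl_repr _).
rewrite word_inv_cat; move: (repr (wcl u)) (repr (wcl v)) => u' v' Kv Ku.
by rewrite -catA (catA v'); apply/(ker_indel kK).
Qed.

Lemma wquot_invE u : wquot_inv (wcl u) = wcl (word_inv u).
Proof.
apply/wcl_eq; have := (wcl_eq (repr (wcl u)) u).1 (wcl_repr _).
by rewrite word_invK => /kernel_inv; rewrite word_inv_cat word_invK; exact: kernel_rotate.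
Qed.

Lemma wcl_surj (s : wquot) : exists u, s = wcl u.
Proof. by exists (repr s); rewrite wcl_repr. Qed.

Lemma wmulA : associative wmul.
Proof.
move=> s t r; have [u ->] := wcl_surj s; have [v ->] := wcl_surj t.
by have [w ->] := wcl_surj r; rewrite !wmulE catA.
Qed.

Lemma wmul1 : left_id (wcl [::]) wmul.
Proof. by move=> s; have [u ->] := wcl_surj s; rewrite wmulE. Qed.

Lemma wmulr1 : right_id (wcl [::]) wmul.
Proof. by move=> s; have [u ->] := wcl_surj s; rewrite wmulE cats0. Qed.

Lemma wmulV : left_inverse (wcl [::]) wquot_inv wmul.
Proof.
move=> s; have [u ->] := wcl_surj s; rewrite wquot_invE wmulE; apply/wcl_eq.
by rewrite cats0; exact: kernel_Vw.
Qed.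

Lemma wmulrV : right_inverse (wcl [::]) wquot_inv wmul.
Proof.
move=> s; have [u ->] := wcl_surj s; rewrite wquot_invE wmulE; apply/wcl_eq.
by rewrite cats0; exact: kernel_word_inv.
Qed.

HB.instance Definition _ := isGroup.Build wquot wmulA wmul1 wmulr1 wmulV wmulrV.

(** The group presented by the kernel, with the classes of words as elements. *)
Lemma kernel_quotient : exists (S : groupType) (cl : word -> S),
  [/\ forall s, exists w, cl w = s, forall u v, cl (u ++ v) = (cl u * cl v)%g &
      forall u, cl u = 1%g <-> K u].
Proof.
exists (wquot : groupType), wcl; split=> [s|u v|u].
- by have [u ->] := wcl_surj s; exists u.
- by rewrite -wmulE.
by have := wcl_eq u [::]; rewrite cats0.
Qed.

End OneKernel.

Lemma action_kernel (X : Type) (act : X -> letter -> X) : is_action act ->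
  kernel [set w | forall x, run_word act x w = x].
Proof.
move=> actP; split=> //.
- move=> u k v Kk; split=> /= Kuv x; have := Kuv x; rewrite !run_cat ?Kk //.
- by move=> a x; rewrite /= actK.
- by move=> i a b x; rewrite /= actP.2 actK.
Qed.

Lemma maximal_kernel (K0 : set word) (c : letter) : kernel K0 -> ~ K0 [:: c] ->
  exists K, [/\ kernel K, K0 `<=` K, ~ K [:: c] &
    forall K', kernel K' -> K `<=` K' -> ~ K' [:: c] -> K' `<=` K].
Proof.
move=> k0 n0.
have [||K [K0K [kK nK] maxK]] := @Zorn_above _ (fun K => kernel K /\ ~ K [:: c]) K0.
- by [].
- move=> F [X0 FX0] okF tot.
  have [K0X0 _] := okF _ FX0; split; last first.
    by move=> [X FX Xc]; have [_ [_]] := okF _ FX; apply.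
  split.
  - by exists X0 => //; apply/K0X0/(ker_nil k0).
  - move=> u k v Uk; split=> Uuv; have [X FX [Xk Xuv]] := chain_pair tot Uk Uuv;
      have [_ [kX _]] := okF _ FX; exists X => //; exact/(ker_indel kX u v Xk).
  - by move=> a; exists X0 => //; apply/K0X0/(ker_inv k0).
  - by move=> i x y; exists X0 => //; apply/K0X0/(ker_mul k0).
by exists K; split=> // K' kK' KK' nK'; apply: maxK.
Qed.

End Quotient.

Definition mk_multiplicative (G S : groupType) (f : G -> S)
  (fM : {morph f : x y / (x * y)%g}) : {multiplicative G -> S} :=
  HB.pack f (isMultiplicative.Build G S f fM).

Section Simple.
Local Open Scope classical_set_scope.
Variables (I : choiceType) (H : I -> groupType).
Local Notation letter := {i : I & H i}.
Local Notation word := (seq letter).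
Variables (big : I -> Prop) (y : forall e, letter -> letter -> nat -> H e).
Hypothesis y1 : forall e a b k, big e -> y e a b k != 1%g.
Hypothesis y_inj : forall e a b k a' b' k', big e ->
  y e a b k = y e a' b' k' \/ y e a b k = (y e a' b' k')^-1%g ->
  [/\ a = a', b = b' & k = k'].
Hypothesis H_nontriv : forall i, exists x : H i, x != 1%g.
Hypothesis three_big : forall i, exists e1 e2,
  [/\ big e1, big e2, e1 != e2, e1 != i & e2 != i].

Section Class.
Variables (S : groupType) (cl : word -> S).
Hypothesis clM : forall u v, cl (u ++ v) = (cl u * cl v)%g.
Hypothesis cl_inv : forall a, cl [:: a; letter_inv a] = 1%g.
Hypothesis cl_mul : forall i (x z : H i),
  cl [:: Tagged H x; Tagged H z; letter_inv (Tagged H (x * z)%g)] = 1%g.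
Hypothesis cl_rel : forall e a b, relator_index big e a b -> cl (relator y e a b) = 1%g.
Local Notation clx a := (cl [:: a]).

Lemma cl_nil : cl [::] = 1%g.
Proof. by apply: (mulIg (cl [::])); rewrite -clM mul1g. Qed.

Lemma cl_letter_inv a : clx (letter_inv a) = (clx a)^-1%g.
Proof.
by apply: (mulgI (clx a)); rewrite mulgV -clM cl_inv.
Qed.

Lemma cl_cons a w : cl (a :: w) = (clx a * cl w)%g.
Proof. by rewrite -clM. Qed.

Lemma clxM i (x z : H i) : clx (Tagged H (x * z)%g) =
    (clx (Tagged H x) * clx (Tagged H z))%g.
Proof.
apply: (mulIg (clx (letter_inv (Tagged H (x * z)%g)))).
by rewrite -clM cl_inv -mulgA -!clM cl_mul.
Qed.

Lemma clx1 (a : letter) : tagged a = 1%g -> clx a = 1%g.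
Proof.
by case: a => i x /= ->; apply: (mulIg (clx (Tagged H (1%g : H i))));
  rewrite mul1g -clxM mulg1.
Qed.

Lemma relator_cons e a b : relator y e a b =
  letter_inv b :: [seq rel_nth y e a b p.+1 | p <- iota 0 148].
Proof. by rewrite /relator /mkseq /rel_len /= -[1]/(0 + 1)%N. Qed.

Lemma cl_relatorE e a b : relator_index big e a b ->
  clx b = cl [seq rel_nth y e a b p.+1 | p <- iota 0 148].
Proof.
move=> /cl_rel; rewrite relator_cons cl_cons cl_letter_inv => h.
by apply: (mulgI (clx b)^-1%g); rewrite mulVg h.
Qed.

Lemma subgroup_word (B : set S) w : is_subgroup B -> (forall a, a \in w -> B (clx a)) ->
  B (cl w).
Proof.
move=> sB; have [B1 _] := sB; have BM := group_closedM sB.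
elim: w => [|a w IH] Bw; first by rewrite cl_nil; apply: set_mem.
rewrite cl_cons; apply: set_mem; apply: BM; apply: mem_set.
  by apply: Bw; rewrite mem_head.
by apply: IH => c cw; apply: Bw; rewrite inE cw orbT.
Qed.

(** A letter [a] of a third factor is, by the relator with [a] on one side, a
    product of letters of the factors [i] and [e]. *)
Lemma subgroup_all (B : set S) i e : is_subgroup B -> i != e -> big e ->
  (forall a : letter, tag a == i \/ tag a == e -> B (clx a)) -> forall a, B (clx a).
Proof.
move=> sB ie be Bie a.
have [ai|ai] := eqVneq (tag a) i; first by apply: Bie; left; apply/eqP.
have [ae|ae] := eqVneq (tag a) e; first by apply: Bie; right; apply/eqP.
have B1 : B 1%g by have [h _] := sB; exact: set_mem.
have [a1|a1] := eqVneq (tagged a) 1%g.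
  by rewrite clx1.
have [h h1] := H_nontriv i.
have v : relator_index big e (Tagged H h) a by split=> //; split=> //=; rewrite eq_sym.
rewrite (cl_relatorE v); apply: subgroup_word => // c /mapP[p _ ->]; apply: Bie.
by rewrite tag_rel_nth /=; case: ifP => _; [right|left].
Qed.

(** Without the letter [a], the relator reads b^-1 y_0 y_0^-1 y_1 y_1^-1 ... *)
Lemma relator_kill e a b : relator_index big e a b -> clx a = 1%g -> clx b = 1%g.
Proof.
move=> v ca; have := cl_rel v.
have cl_rcons w c : cl (rcons w c) = (cl w * clx c)%g by rewrite -cats1 clM.
have prefix n : cl (mkseq (rel_nth y e a b) n.*2.*2.+1) = (clx b)^-1%g.
  elim: n => [|n IH]; first by rewrite /mkseq /= cl_letter_inv.
  have -> : n.+1.*2.*2.+1 = n.*2.*2.+1.+4 by rewrite !doubleS.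
  rewrite (mkseqS _ n.*2.*2.+4) (mkseqS _ n.*2.*2.+3) (mkseqS _ n.*2.*2.+2) (mkseqS _ n.*2.*2.+1).
  rewrite !cl_rcons IH -[n.*2.*2.+4]/(n.*2.+2.*2) -[n.*2.*2.+3]/(n.*2.+1.*2.+1).
  rewrite -[n.*2.*2.+2]/(n.*2.+1.*2) !rel_nth_even // !rel_nth_odd ca !mulg1.
  rewrite /y_pattern /= odd_double /= uphalf_double doubleK.
  by rewrite cl_letter_inv mulgK.
by have := prefix 37; rewrite -[37.*2.*2.+1]/rel_len -/(relator y e a b) => ->
  /(congr1 (fun s => s^-1)%g); rewrite invgK invg1.
Qed.

(** Two factors [e1] and [e2] of cardinality lambda differ from the factor of
    [a].  The relators that use them kill all the letters outside the factor of
    [a], and [e1] and [e2] generate that factor too. *)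
Lemma letters_killed (a : letter) : tagged a != 1%g -> clx a = 1%g -> forall b, clx b = 1%g.
Proof.
move=> a1 ca; have kill e b : big e -> e != tag a -> tag b != tag a -> tag b != e ->
    clx b = 1%g.
  move=> be ea ba bne.
  have [/clx1//|b1] := eqVneq (tagged b) 1%g.
  have v : relator_index big e a b by split=> //; split=> //; rewrite eq_sym.
  exact: relator_kill v ca.
have [e1 [e2 [b1 b2 e12 e1a e2a]]] := three_big (tag a).
have away b : tag b != tag a -> clx b = 1%g.
  move=> ba; have [be|be] := eqVneq (tag b) e1; last exact: kill be.
  by apply: (kill e2) => //; rewrite be.
have sub1 : is_subgroup [set 1%g : S].
  split; first exact: mem_set.
  by move=> u v /set_mem -> /set_mem ->; apply: mem_set; rewrite /= divgg.
move=> b; apply: (subgroup_all sub1 e12 b2) => c ct; apply: away.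
by apply/eqP => cta; case: ct => /eqP ct; [move: e1a|move: e2a]; rewrite -ct cta eqxx.
Qed.

End Class.

(** A maximal kernel that contains the relators and misses one letter. *)
Theorem simple_group_of_relators (i0 : I) : exists (S : groupType)
    (phi : forall i, {multiplicative H i -> S}) (cl : word -> S),
  [/\ simple_group S, forall i, injective (phi i),
      forall i e, i != e -> big e ->
        generated_subgroup (range (phi i) `|` range (phi e)) = [set: S] &
      forall s, exists w, cl w = s].
Proof.
have [x0 x01] := H_nontriv i0; pose a0 : letter := Tagged H x0.
have [X [act [p [actP relX moveX]]]] :=
  small_cancellation_action a0 (relators_sc y1 y_inj) isT isT.
have k0 := action_kernel actP.
have [|K [kK K0K nK maxK]] := @maximal_kernel _ _ _ a0 k0.
  by move=> /(_ p) /=; apply: moveX.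
have [S [cl [cl_surj clM clK]]] := kernel_quotient kK.
have relK e a b : relator_index big e a b -> K (relator y e a b).
  move=> v; apply: K0K => x; apply: relX; exists e, a, b, 0.
  by split; rewrite ?rot0.
have cl_inv a : cl [:: a; letter_inv a] = 1%g by apply/clK; exact: (ker_inv kK).
have cl_mul i (x z : H i) :
    cl [:: Tagged H x; Tagged H z; letter_inv (Tagged H (x * z)%g)] = 1%g.
  by apply/clK; exact: (ker_mul kK).
have cl_rel e a b : relator_index big e a b -> cl (relator y e a b) =
  1%g by move=> /relK/clK.
pose f i (x : H i) := cl [:: Tagged H x].
have fM i : {morph @f i : x z / (x * z)%g} by move=> x z; exact: clxM.
exists S, (fun i => mk_multiplicative (fM i)), cl.
have na0 : cl [:: a0] <> 1%g by move=> /clK.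
split=> //.
- split; first by exists (cl [:: a0]).
  move=> N [sN nN]; have [N1 ND] := sN.
  have NM u v : N u -> N v -> N (u * v)%g.
    by move=> Nu Nv; apply: set_mem; apply: (group_closedM sN); exact: mem_set.
  have NV u : N u -> N u^-1%g.
    by move=> Nu; apply: set_mem; apply: (group_closedV sN); exact: mem_set.
  pose K' : set word := [set w | N (cl w)].
  have N1' : N 1%g by exact: set_mem.
  have KK' : K `<=` K' by move=> w /clK; rewrite /K' /= => ->.
  have kK' : kernel K'.
    split=> [|u k v Kk|a|i x z]; try by apply: KK'; case: kK.
    rewrite /K' /= !clM; split=> h.
      have -> : (cl u * cl v = (cl k)^-1 ^ (cl u)^-1 * (cl u * (cl k * cl v)))%g.
        by rewrite /conjg invgK !mulgA !mulgVK.
      by apply: NM => //; apply/nN/NV.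
    have -> : (cl u * (cl k * cl v) = (cl k) ^ (cl u)^-1 * (cl u * cl v))%g.
      by rewrite /conjg invgK !mulgA mulgVK.
    by apply: NM => //; apply: nN.
  have [Na0|nNa0] := pselect (N (cl [:: a0])); last first.
    left; apply/seteqP; split=> [s Ns|s ->//].
    have [w es] := cl_surj s; rewrite -es /=; apply/clK; apply: (maxK K') => //.
    by rewrite /K' /= es.
  right; apply/seteqP; split=> // s _.
  (* the quotient of [S] by [N] is a group in which the relators hold and the
     letter [a0] dies *)
  have [T [dl [dl_surj dlM dlK]]] := kernel_quotient kK'.
  have dlx : forall b, dl [:: b] = 1%g.
    apply: (@letters_killed T dl dlM _ _ _ a0) => //.
    + by move=> a; apply/dlK; exact: (ker_inv kK').
    + by move=> i x z; apply/dlK; exact: (ker_mul kK').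
    + by move=> e a b v; apply/dlK; apply: KK'; exact: relK.
    + exact/dlK.
  have [w <-] := cl_surj s; suff : K' w by [].
  apply/dlK; elim: w {s} => [|c w IH]; first exact: cl_nil.
  by rewrite -cat1s dlM dlx IH mulg1.
- move=> i x z /= /(congr1 (fun s => (cl [:: Tagged H x]) * s^-1)%g).
  rewrite /f mulgV -cl_letter_inv // -clM => h.
  have : cl [:: Tagged H (x * z^-1)%g] = 1%g.
    by rewrite clxM // -clM; exact: esym h.
  have [xz _|xz] := eqVneq (x * z^-1)%g 1%g; last first.
    by move=> /(@letters_killed S cl clM cl_inv cl_mul cl_rel (Tagged H (x * z^-1)%g) xz)/(_ a0).
  exact: divg1_eq.
move=> i e ie be; apply/seteqP; split=> // s _ B [sB subB].
have [w <-] := cl_surj s; apply: (subgroup_word clM sB) => a _.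
apply: (subgroup_all clM cl_inv cl_mul cl_rel sB ie be) => {}a at_; apply: subB.
by case: a at_ => j x /= [] /eqP ej; subst j; [left|right]; exists x.
Qed.

End Simple.

(** * The theorem *)

Section LetterCount.
Local Open Scope classical_set_scope.
Local Open Scope card_scope.

Lemma injective_letters (L I : Type) (H : I -> groupType) : infinite_set [set: L] ->
  (exists f : I -> L, injective f) -> (forall i, exists f : H i -> L, injective f) ->
  exists f : {i : I & H i} -> L, injective f.
Proof.
move=> L_inf [f fI] gex; have [p pI] := infinite_pairing L_inf.
pose g i := sval (cid (gex i)).
have gI i : injective (g i) by exact: svalP (cid (gex i)).
exists (fun a => p (f (tag a)) (g (tag a) (tagged a))) => -[i x] [j z] /= /pI[/fI ij].
by subst j => /gI ->.
Qed.

Lemma injective_option (L I : Type) : infinite_set [set: L] ->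
  (exists f : I -> L, injective f) -> exists f : option I -> L, injective f.
Proof.
move=> L_inf [f fI]; have [p pI] := infinite_pairing L_inf.
have [nu nuI] : exists nu : nat -> L, injective nu by apply/card_le_injP/infiniteP.
exists (fun o => if o is Some i then p (nu 0) (f i) else p (nu 1) (nu 1)).
by move=> [i|] [j|] // /pI[] => [_ /fI ->|/nuI|/nuI].
Qed.

End LetterCount.

Unset Implicit Arguments.
Set Strict Implicit.
Set Printing Implicit Defensive.
Local Open Scope classical_set_scope.
Local Open Scope card_scope.

(* The cardinal lambda is given as the cardinality of an infinite type L. *)
Theorem theoremB (L I : Type) (H : I -> groupType)
    (L_infinite : infinite_set [set: L])
    (H_nontrivial : forall i : I, nontrivial_group (H i))
    (I_ge2 : `I_2 #<= [set: I])
    (I_le_L : [set: I] #<= [set: L])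
    (H_le_L : forall i : I, [set: H i] #<= [set: L])
    (H_eq_L : exists k : I, [set: H k] #= [set: L]) :
  exists (S : groupType) (phi : forall i : I, {multiplicative H i -> S}),
    [/\ simple_group S,
        [set: S] #= [set: L],
        forall i : I, injective (phi i) &
        forall i i' : I, i <> i' -> [set: H i'] #= [set: L] ->
          generated_subgroup (range (phi i) `|` range (phi i')) = [set: S]].
Proof.
have [k Hk] := H_eq_L.
(* the indices [None] and [Some None] stand for two more copies of [H k] *)
pose J : choiceType := option (option {classic I}).
pose HJ (j : J) : groupType := if j is Some (Some i) then H i else H k.
pose big (j : J) : Prop := [set: HJ j] #= [set: L].
have [p pI] := infinite_pairing L_infinite.
have [nu nuI] : exists nu : nat -> L, injective nu by apply/card_le_injP/infiniteP.
have [f fI] : exists f : {j : J & HJ j} -> L, injective f.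
  apply: injective_letters => //.
    do 2!apply: injective_option => //; exact/card_le_injP.
  by move=> [[i|]|]; apply/card_le_injP; apply: H_le_L.
have y_ex (e : J) : exists y : {j : J & HJ j} -> {j : J & HJ j} -> nat -> HJ e,
    big e -> (forall a b n, y a b n != 1%g) /\
    forall a b n a' b' n', y a b n = y a' b' n' \/ y a b n = (y a' b' n')^-1%g ->
      [/\ a = a', b = b' & n = n'].
  have [be|nbe] := pselect (big e); last by exists (fun _ _ _ => 1%g).
  have [g gI] : exists g : L -> HJ e, injective g.
    by apply/card_le_injP; move: be; rewrite /big card_eq_le => /andP[].
  have HJ_inf : infinite_set [set: HJ e].
    by move=> fin; apply: L_infinite; apply: card_le_finite fin; apply/card_le_injP;
      exists g.
  pose tau (t : {j : J & HJ j} * {j : J & HJ j} * nat) : HJ e :=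
    g (p (p (f t.1.1) (f t.1.2)) (nu t.2)).
  have tauI : injective tau.
    by move=> [[a b] n] [[a' b'] n'] /gI/pI[/pI[/fI /= -> /fI /= ->] /nuI /= ->].
  have [y [y1 yI]] := inverse_free_family HJ_inf tauI.
  exists (fun a b n => y (a, b, n)) => _; split=> // a b n a' b' n' /yI[].
  by move=> -> -> ->.
pose y e := sval (cid (y_ex e)).
have yP e := svalP (cid (y_ex e)).
have H_nontriv (j : J) : exists x : HJ j, x != 1%g.
  by case: j => [[i|]|]; [have [x /eqP] := H_nontrivial i|
    have [x /eqP] := H_nontrivial k|have [x /eqP] := H_nontrivial k]; exists x.
have three_big (j : J) : exists e1 e2, [/\ big e1, big e2, e1 != e2, e1 != j & e2 != j].
  case: j => [[i|]|].
  - by exists None, (Some None).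
  - by exists None, (Some (Some k)).
  - by exists (Some None), (Some (Some k)).
have [S [phi [cl [S_simple phiI gen cl_surj]]]] := @simple_group_of_relators J HJ big y
  (fun e a b n be => (yP e be).1 a b n)
  (fun e a b n a' b' n' be => (yP e be).2 a b n a' b' n') H_nontriv three_big None.
exists S, (fun i => phi (Some (Some i))); split=> //.
- rewrite card_eq_le; apply/andP; split; apply/card_le_injP.
    have [e eI] := infinite_seq L_infinite.
    have [w wP] := boolp.choice cl_surj.
    exists (fun s => e (map f (w s))) => s t /eI/(inj_map fI) ww.
    by rewrite -(wP s) ww wP.
  have [g gI] : exists g : L -> H k, injective g.
    by apply/card_le_injP; move: Hk; rewrite card_eq_le => /andP[].
  by exists (fun x => phi None (g x)) => x z /phiI/gI.
- by move=> i; exact: (phiI (Some (Some i))).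
move=> i i' ii' bi'; apply: (gen (Some (Some i)) (Some (Some i'))) => //.
by apply/eqP => -[].
Qed.
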